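(* For a positive integer $s$ let $T_3(s)=\max_{\mathcal{L}} t_3(\mathcal{L})$, the maximum taken over all arrangements $\mathcal{L}$ of $s$ lines in $\mathbb{P}^2(\mathbb{K})$ over all fields $\mathbb{K}$, where $t_3(\mathcal{L})$ is the number of points lying on exactly three lines of $\mathcal{L}$. Then $$T_3(12)=19,\quad 23\le T_3(13)\le 24,\quad T_3(14)=28,\quad T_3(15)=35,\quad T_3(16)=37,\quad T_3(17)\ge 40,\quad T_3(18)=48,\quad T_3(19)=57.$$ More precisely: (i) there does not exist an arrangement of $12$ lines with $20$ triple points; (i') there exists an arrangement of $12$ lines with $19$ triple points; (ii) there does not exist an arrangement of $13$ lines with $25$ or $26$ triple points; (ii') there exists an arrangement of $13$ lines with $23$ triple points; (iii) there exists an arrangement of $14$ lines with $28$ triple points; (iv) there exists an arrangement of $15$ lines with $35$ triple points; (v) there exists an arrangement of $16$ lines with $37$ triple points; (vi) there exists an arrangement of $17$ lines with $40$ triple points; (vii) there exists an arrangement of $18$ lines with $48$ triple points; (viii) there exists an arrangement of $19$ lines with $57$ triple points. (Here ''arrangement'' allows any field $\mathbb{K}$.)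
   Context: A line arrangement is a finite set of distinct lines in the projective plane $\mathbb{P}^2(\mathbb{K})$ over some field $\mathbb{K}$; a triple point of the arrangement is a point through which exactly three of its lines pass. For comparison, the combinatorial (Schönheim) upper bound is $T_3(s)\le U_3(s)=\left\lfloor\left\lfloor\frac{s-1}{2}\right\rfloor\frac{s}{3}\right\rfloor-\varepsilon(s)$ with $\varepsilon(s)=1$ if $s\equiv 5 \pmod 6$ and $\varepsilon(s)=0$ otherwise; its values for $s=12,\dots,19$ are $20,26,28,35,37,44,48,57$. *)

(* Defs.v *)
From HB Require Import structures.
From mathcomp Require Import all_boot all_order all_algebra finmap.
From mathcomp Require Import boolp classical_sets functions cardinality.

Set Implicit Arguments.
Unset Strict Implicit.
Unset Printing Implicit Defensive.

Import GRing.Theory.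

(* Points and lines of P^2(K) are the vector subspaces of K^3 of dimension 1   *)
(* and 2 respectively; incidence is inclusion.                                *)
Definition point (K : fieldType) : Type :=
  {P : {vspace 'rV[K]_3} | \dim P == 1}.
HB.instance Definition _ (K : fieldType) := Choice.on (point K).

Definition line (K : fieldType) : Type :=
  {l : {vspace 'rV[K]_3} | \dim l == 2}.
HB.instance Definition _ (K : fieldType) := Choice.on (line K).

Definition incident (K : fieldType) (P : point K) (l : line K) : bool :=
  (val P <= val l)%VS.

Definition arrangement (K : fieldType) : Type := {fset line K}.

Definition lines_through (K : fieldType) (L : arrangement K) (P : point K) :
  {fset line K} := [fset l in L | incident P l]%fset.

Definition triple_points (K : fieldType) (L : arrangement K) : set (point K) :=
  [set P | #|` lines_through L P| = 3]%classic.

(* [fset_set] is a junk value on infinite sets; [finite_triple_points] below   *)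
(* shows that it is only used on finite ones here.                            *)
Definition t3 (K : fieldType) (L : arrangement K) : nat :=
  #|` fset_set (triple_points L)|.

Definition has_arrangement (s t : nat) : Prop :=
  exists (K : fieldType) (L : arrangement K), #|` L| = s /\ t3 L = t.

Lemma lines_through_inj (K : fieldType) (L : arrangement K) :
  {in triple_points L &, injective (lines_through L)}.
Proof.
move=> P Q; rewrite !inE /triple_points /= => hP _ e.
have [l1 [l2 [h1 h2 d12]]] : exists l1 l2, [/\ l1 \in lines_through L P,
    l2 \in lines_through L P & l1 != l2].
  have /fset0Pn [l1 h1] : lines_through L P != fset0.
    by rewrite -cardfs_gt0 hP.
  have /fset0Pn [l2] : (lines_through L P `\ l1)%fset != fset0.
    by rewrite -cardfs_gt0; have := cardfsD1 l1 (lines_through L P);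
       rewrite hP h1 add1n => -[<-].
  by rewrite in_fsetD1 => /andP[n h2]; exists l1, l2; split; rewrite // eq_sym.
have inc (R : point K) (l : line K) : l \in lines_through L R ->
    (val R <= val l)%VS by rewrite !inE => /andP[].
have dcap : \dim (val l1 :&: val l2)%VS <= 1.
  have d1 := eqP (valP l1); have d2 := eqP (valP l2).
  rewrite leqNgt; apply/negP => d; case/negP: d12; apply/eqP/val_inj/eqP.
  have c1 : (val l1 :&: val l2 == val l1)%VS.
    by rewrite eqEdim capvSl /= d1.
  have c2 : (val l1 :&: val l2 == val l2)%VS.
    by rewrite eqEdim capvSr /= d2.
  exact/eqP/(etrans (esym (eqP c1)) (eqP c2)).
have Pc : (val P == val l1 :&: val l2)%VS.
  by rewrite eqEdim subv_cap !inc //= (eqP (valP P)).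
have Qc : (val Q == val l1 :&: val l2)%VS.
  by rewrite eqEdim subv_cap !inc -?e //= (eqP (valP Q)).
by apply/val_inj; rewrite (eqP Pc) (eqP Qc).
Qed.

Lemma lines_through_sub (K : fieldType) (L : arrangement K) (P : point K) :
  lines_through L P \in fpowerset L.
Proof. by rewrite fpowersetE; apply/fsubsetP => l; rewrite !inE => /andP[]. Qed.

Lemma finite_triple_points (K : fieldType) (L : arrangement K) :
  finite_set (triple_points L).
Proof.
set g := lines_through L.
have fim : finite_set (g @` triple_points L)%classic.
  apply: (sub_finite_set _ (finite_fset (fpowerset L))) => _ [P _ <-] /=.
  exact: lines_through_sub.
by rewrite -(eq_finite_set (inj_card_eq (@lines_through_inj K L))).
Qed.

Lemma t3_bound (K : fieldType) (L : arrangement K) : t3 L <= 2 ^ #|` L|.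
Proof.
rewrite -card_fpowerset /t3.
set A := fset_set _.
have -> : #|` A| = #|` [fset lines_through L P | P in A]%fset|.
  rewrite card_in_imfset //= => P Q.
  rewrite !in_fset_set; try exact: finite_triple_points.
  exact: lines_through_inj.
by apply/fsubset_leq_card/fsubsetP => _ /imfsetP[P _ ->]; apply: lines_through_sub.
Qed.

Local Open Scope ring_scope.

(* A pencil of s distinct lines over Q, so that T3 s is a maximum of a nonempty *)
(* set for every s.                                                           *)
Definition pencil_vec (i : nat) : 'rV[rat]_3 :=
  \row_j (if val j == 0%N then 0 else if val j == 1%N then 1 else i%:R).

Definition pencil_space (i : nat) : {vspace 'rV[rat]_3} :=
  (<[delta_mx 0%R 0%R]> + <[pencil_vec i]>)%VS.

Lemma pencil_space_mem i j : pencil_vec i \in pencil_space j -> i = j.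
Proof.
case/memv_addP => _ /vlineP[a ->] [_ /vlineP[b ->]] e.
have e1 := congr1 (fun M : 'rV[rat]_3 => M 0 1) e.
have e2 := congr1 (fun M : 'rV[rat]_3 => M 0 (inord 2)) e.
have n20 : (inord 2 == 0 :> 'I_3) = false by rewrite -val_eqE /= inordK.
move: e1 e2; rewrite !mxE /= n20 inordK // /= !mulr0 !add0r mulr1 => <-.
by rewrite mul1r => /eqP; rewrite Num.Theory.eqr_nat => /eqP.
Qed.

Lemma pencil_space_dim i : \dim (pencil_space i) == 2.
Proof.
have : free [:: delta_mx 0 0; pencil_vec i].
  rewrite free_cons seq1_free span_seq1; apply/andP; split.
    apply/negP => /vlineP[k e].
    have e0 := congr1 (fun M : 'rV[rat]_3 => M 0 0) e.
    by move: e0; rewrite !mxE /= mulr0 => /eqP; rewrite oner_eq0.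
  apply/eqP => e.
  have e1 := congr1 (fun M : 'rV[rat]_3 => M 0 1) e.
  by move: e1; rewrite !mxE /= => /eqP; rewrite oner_eq0.
by rewrite /free span_cons span_seq1.
Qed.

Local Close Scope ring_scope.

Lemma has_arrangement_ex (s : nat) :
  exists t, `[< has_arrangement s t >].
Proof.
pose l i : line rat := exist _ (pencil_space i) (pencil_space_dim i).
pose L : arrangement rat := [fset l i | i in iota 0 s]%fset.
exists (t3 L); apply/asboolP; exists rat, L; split => //.
rewrite /L card_imfset /= ?undup_id ?iota_uniq ?size_iota // => i j /(congr1 val) /= e.
by apply: pencil_space_mem; rewrite -e; apply: (subvP (addvSr _ _)); exact: memv_line.
Qed.

Lemma has_arrangement_le (s t : nat) :
  `[< has_arrangement s t >] -> t <= 2 ^ s.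
Proof. by move/asboolP => [K [L [<- <-]]]; apply: t3_bound. Qed.

(* The maximum ranges over all fields K and all arrangements of s lines in     *)
(* P^2(K); it exists since s lines have at most 2 ^ s triple points.          *)
Definition T3 (s : nat) : nat :=
  ex_maxn (has_arrangement_ex s) (@has_arrangement_le s).

Lemma T3P (s : nat) :
  has_arrangement s (T3 s) /\ (forall t, has_arrangement s t -> t <= T3 s).
Proof.
rewrite /T3; case: ex_maxnP => t /asboolP ht ub; split => // u hu.
by apply: ub; apply/asboolP.
Qed.

(* Main.v *)
(* View s lines, through their normal vectors, as s points of the dual plane;   *)
(* triple points become the lines through exactly three of them.  Any line of   *)
(* the arrangement carries at most (s - 1) / 2 triple points, whence            *)
(* 3 t <= s (s - 1) / 2 up to rounding; this settles every upper bound but      *)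
(* those for s = 12 and 13.                                                     *)
(*                                                                              *)
(* Twelve lines with 20 triple points would have 5 triple points on each line,  *)
(* so each line would meet all the others but one, its partner, in triple       *)
(* points: a group divisible design with block size 3 and six groups of size 2. *)
(* There are five such designs up to isomorphism.  Four of them contain a       *)
(* Pappus configuration with its last collinearity missing, and the fifth       *)
(* violates another closure theorem, on eleven points.  The case analysis is a  *)
(* tree in which lines are labelled in order of appearance, each step branching *)
(* on the third line through the intersection of two labelled ones.             *)
(*                                                                              *)
(* Deleting the line with the fewest triple points from thirteen lines with at  *)
(* least 25 triple points leaves at least 20, so the case of 13 lines follows.  *)

From HB Require Import structures.
From mathcomp Require Import all_boot all_order all_algebra finmap.
From mathcomp Require Import boolp classical_sets functions cardinality.
From mathcomp Require Import ring zify.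
Require Import Defs.

Set Implicit Arguments.
Unset Strict Implicit.
Unset Printing Implicit Defensive.

Import GRing.Theory.

(** The translation into linear algebra is [has_arrangementP]: an arrangement is a family of
    pairwise non-proportional vectors, concurrence is the vanishing of [det3], and [t3] counts the
    increasing index triples that satisfy [exactly]. In these triples two lines determine the third,
    so they form a partial Steiner triple system. A line therefore has at most floor((s - 1) / 2)
    triple points, and summing over the lines gives [has_arrangement_le_schonheim], which is
    attained for s = 14, 15, 16, 18 and 19.

    For s = 12 that bound is 20, and equality forces five triple points on every line;
    [unique_partner] then supplies the pairing of the lines. By [refute_sound], a tree accepted by
    the checker [refute] shows that no such system of triples is closed under both [pappus] and
    [twelve_point_closure]. These two closure theorems come down to polynomial identities with
    integer coefficients, hence hold over every field, and [twelve_cert] is an accepted tree. The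
    averaging in [delete_line] carries the bound 19 for twelve lines to 24 for thirteen.

    The lower bounds are explicit coordinates over F_7, F_11 and F_16, verified by computation
    through [model_arrangement]: an orbit of a Singer subgroup, subgroups of elliptic curves, a
    projection of PG(3, 2), a symmetric set found by search, and subsets of the first and third of
    these. *)

Local Notation cX u := (u 0%R (@Ordinal 3 0 isT)).
Local Notation cY u := (u 0%R (@Ordinal 3 1 isT)).
Local Notation cZ u := (u 0%R (@Ordinal 3 2 isT)).

(** * Lines of the plane and their normal vectors *)

Section Plane.
Local Open Scope ring_scope.
Variable K : fieldType.
Implicit Types (u v w x : 'rV[K]_3) (P : point K) (l : line K).

Definition vec3 (a b c : K) : 'rV[K]_3 :=
  \row_j (if val j == 0%N then a else if val j == 1%N then b else c).

Definition dot u v : K := cX u * cX v + cY u * cY v + cZ u * cZ v.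

Definition cross u v : 'rV[K]_3 :=
  vec3 (cY u * cZ v - cZ u * cY v) (cZ u * cX v - cX u * cZ v)
       (cX u * cY v - cY u * cX v).

Definition det3 u v w : K := dot (cross u v) w.

Lemma vec3_0 a b c : cX (vec3 a b c) = a. Proof. by rewrite mxE. Qed.
Lemma vec3_1 a b c : cY (vec3 a b c) = b. Proof. by rewrite mxE. Qed.
Lemma vec3_2 a b c : cZ (vec3 a b c) = c. Proof. by rewrite mxE. Qed.
Definition vec3E := (vec3_0, vec3_1, vec3_2).

Lemma rV3P u v : cX u = cX v -> cY u = cY v -> cZ u = cZ v -> u = v.
Proof.
move=> e0 e1 e2; apply/rowP => -[[|[|[|//]]] h] /=.
- by rewrite (_ : Ordinal h = @Ordinal 3 0 isT) //; apply: val_inj.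
- by rewrite (_ : Ordinal h = @Ordinal 3 1 isT) //; apply: val_inj.
- by rewrite (_ : Ordinal h = @Ordinal 3 2 isT) //; apply: val_inj.
Qed.

Lemma dotE u v : (u *m v^T) 0 0 = dot u v.
Proof.
rewrite mxE !big_ord_recr big_ord0 /= add0r !mxE.
by congr (_ + _ + _); congr (u _ _ * v _ _); apply: val_inj.
Qed.

Lemma det3E u v w : det3 u v w =
  (cY u * cZ v - cZ u * cY v) * cX w + (cZ u * cX v - cX u * cZ v) * cY w
  + (cX u * cY v - cY u * cX v) * cZ w.
Proof. by rewrite /det3 /dot !vec3E. Qed.

Lemma crossC u v : cross v u = - cross u v.
Proof. by apply: rV3P; rewrite [RHS]mxE !vec3E; ring. Qed.

Lemma det3C u v w : det3 v u w = - det3 u v w.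
Proof. by rewrite !det3E; ring. Qed.

Lemma det3_rot u v w : det3 v w u = det3 u v w.
Proof. by rewrite !det3E; ring. Qed.

Lemma det3_swap u v w : det3 u w v = - det3 u v w.
Proof. by rewrite !det3E; ring. Qed.

Lemma dot_crossl u v : dot (cross u v) u = 0.
Proof. by rewrite /dot !vec3E; ring. Qed.

Lemma dot_crossr u v : dot (cross u v) v = 0.
Proof. by rewrite /dot !vec3E; ring. Qed.

Lemma dotZl a u v : dot (a *: u) v = a * dot u v.
Proof. by rewrite /dot !mxE; ring. Qed.

Lemma rV3_neq0 u : u != 0 -> [|| cX u != 0, cY u != 0 | cZ u != 0].
Proof.
apply: contraR; rewrite !negb_or !negbK => /and3P[/eqP e0 /eqP e1 /eqP e2].
by apply/eqP/rV3P; rewrite ?e0 ?e1 ?e2 mxE.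
Qed.

Lemma proportionalP u v : u != 0 ->
  cX u * cY v = cY u * cX v -> cX u * cZ v = cZ u * cX v ->
  cY u * cZ v = cZ u * cY v -> exists k, v = k *: u.
Proof.
move=> /rV3_neq0 /or3P[] n e01 e02 e12.
- exists (cX v / cX u); apply/rV3P; rewrite !mxE; apply: (mulfI n);
    rewrite ?e01 ?e02; field; exact: n.
- exists (cY v / cY u); apply/rV3P; rewrite !mxE; apply: (mulfI n);
    rewrite -?e01 ?e12; field; exact: n.
- exists (cZ v / cZ u); apply/rV3P; rewrite !mxE; apply: (mulfI n);
    rewrite -?e02 -?e12; field; exact: n.
Qed.

Lemma cross_eq0 u v : u != 0 -> cross u v = 0 -> exists k, v = k *: u.
Proof.
move=> nz e.
have z0 := vec3_0 (cY u * cZ v - cZ u * cY v) (cZ u * cX v - cX u * cZ v) (cX u * cY v - cY u * cX v).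
have z1 := vec3_1 (cY u * cZ v - cZ u * cY v) (cZ u * cX v - cX u * cZ v) (cX u * cY v - cY u * cX v).
have z2 := vec3_2 (cY u * cZ v - cZ u * cY v) (cZ u * cX v - cX u * cZ v) (cX u * cY v - cY u * cX v).
move: z0 z1 z2; rewrite -/(cross u v) e !mxE => z0 z1 z2.
apply: proportionalP => //; apply/eqP.
- by rewrite -subr_eq0 -z2.
- by rewrite eq_sym -subr_eq0 -z1.
- by rewrite -subr_eq0 -z0.
Qed.

(** By the triple product expansion, the cross product of [cross u v] and [x] is [dot x u] times [v]
    minus [dot x v] times [u], which vanishes here. *)
Lemma orthogonal_cross u v x : cross u v != 0 -> dot x u = 0 -> dot x v = 0 ->
  exists k, x = k *: cross u v.
Proof.
move=> nz xu xv; apply: proportionalP => //; rewrite !vec3E; apply/eqP; rewrite -subr_eq0; apply/eqP.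
- transitivity (cZ v * dot x u - cZ u * dot x v); first by rewrite /dot; ring.
  by rewrite xu xv; ring.
- transitivity (cY u * dot x v - cY v * dot x u); first by rewrite /dot; ring.
  by rewrite xu xv; ring.
- transitivity (cX v * dot x u - cX u * dot x v); first by rewrite /dot; ring.
  by rewrite xu xv; ring.
Qed.

Definition normal_to l u := forall x, (x \in val l) = (dot x u == 0).

Definition orth u : {vspace 'rV[K]_3} := lker (linfun (mulmxr u^T)).

Lemma mem_orth u x : (x \in orth u) = (dot x u == 0).
Proof.
rewrite memv_ker lfunE /=; apply/eqP/eqP => [e|e]; first by rewrite -dotE e mxE.
by apply/matrixP => i j; rewrite !ord1 dotE e mxE.
Qed.

(** Rank-nullity: pairing with [u] maps onto a space of dimension at most 1, and the image is
    nonzero because the basis vectors recover the coordinates of [u]. *)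
Lemma dim_orth u : u != 0 -> \dim (orth u) = 2%N.
Proof.
move=> nz; have := limg_ker_dim (linfun (mulmxr u^T)) (fullv : {vspace 'rV[K]_3}).
rewrite capfv dimvf dim_matrix => e.
have : (\dim (linfun (mulmxr u^T) @: (fullv : {vspace 'rV[K]_3})) <= 1)%N.
  by apply: leq_trans (dimvS (subvf _)) _; rewrite dimvf dim_matrix.
have : (0 < \dim (linfun (mulmxr u^T) @: (fullv : {vspace 'rV[K]_3})))%N.
  rewrite lt0n dimv_eq0; apply/negP => /eqP z.
  have zd x : dot x u = 0.
    have : linfun (mulmxr u^T) x \in (linfun (mulmxr u^T) @: (fullv : {vspace 'rV[K]_3}))%VS.
      by rewrite memv_img ?memvf.
    by rewrite z memv0 lfunE /= => /eqP z1; rewrite -dotE z1 mxE.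
  case/negP: nz; apply/eqP/rV3P; rewrite mxE.
  - by rewrite -(zd (vec3 1 0 0)) /dot !vec3E; ring.
  - by rewrite -(zd (vec3 0 1 0)) /dot !vec3E; ring.
  - by rewrite -(zd (vec3 0 0 1)) /dot !vec3E; ring.
rewrite /orth => p1 p2; move: e; rewrite (_ : \dim (limg _) = 1%N); last by apply/eqP; rewrite eqn_leq p2.
by rewrite addn1 => -[].
Qed.

(** A normal is the cross product of a basis of the plane; it is nonzero because the basis is
    free. *)
Lemma exists_normal l : exists2 u, u != 0 & normal_to l u.
Proof.
have dl := eqP (valP l).
have := vbasisP (val l); set b := vbasis _.
have szb : size b = 2 by rewrite size_tuple dl.
case: (tval b) szb => [|p [|q []]] //= _ bP.
have /andP[/eqP sp fr] := bP.
move: fr; rewrite free_cons seq1_free span_seq1 => /andP[pq q0].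
have cn : cross p q != 0.
  apply: contraNneq pq => e.
  have [k ->] : exists k, p = k *: q.
    by apply: cross_eq0; rewrite // crossC e oppr0.
  by rewrite memvZ ?memv_line.
exists (cross p q) => // x; rewrite -mem_orth.
suff -> : val l = orth (cross p q) by [].
apply/eqP; rewrite eqEdim dl dim_orth // leqnn andbT -[X in (X <= _)%VS]sp.
by apply/span_subvP => y; rewrite !inE mem_orth => /orP[] /eqP->;
  apply/eqP; rewrite /dot !vec3E; ring.
Qed.

Definition line_of u (nz : u != 0) : line K := exist _ (orth u) (introT eqP (dim_orth nz)).

Lemma normal_line_of u (nz : u != 0) : normal_to (line_of nz) u.
Proof. by move=> x; rewrite mem_orth. Qed.

Lemma normal_cross l m u v : u != 0 -> v != 0 -> normal_to l u ->
  normal_to m v -> l != m -> cross u v != 0.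
Proof.
move=> nu nv lu mv; apply: contraNneq => /(cross_eq0 nu)[k e].
have k0 : k != 0 by apply: contraNneq nv => k0; rewrite e k0 scale0r.
apply/eqP/val_inj/vspaceP => x; rewrite lu mv e.
have -> : dot x (k *: u) = k * dot x u by rewrite /dot !mxE; ring.
by rewrite mulf_eq0 (negbTE k0).
Qed.

Lemma point_vec P : exists2 p, p != 0 & val P = <[p]>%VS.
Proof.
have dP := eqP (valP P).
exists (vpick (val P)); first by rewrite vpick0 -dimv_eq0 dP.
apply/esym/eqP; rewrite eqEdim -memvE memv_pick /= dim_vline vpick0 -dimv_eq0 dP //.
Qed.

Definition point_of (p : 'rV[K]_3) (nz : p != 0) : point K.
Proof. by exists <[p]>%VS; rewrite dim_vline nz. Defined.

Lemma incident_dot P l p u : val P = <[p]>%VS -> normal_to l u ->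
  incident P l = (dot p u == 0).
Proof. by move=> e lu; rewrite /incident e -memvE lu. Qed.

End Plane.

(** * Counting triple points *)

(** For distinct lines the three excluded concurrences are equivalent. Listing all of them makes the
    relation symmetric in [i], [j], [k] for any symmetric [z], without geometry. *)
Definition exactly (s : nat) (z : 'I_s -> 'I_s -> 'I_s -> bool) i j k :=
  [&& i != j, i != k, j != k, z i j k &
    [forall l, (l \notin [:: i; j; k]) ==> ~~ [|| z i j l, z i k l | z j k l]]].

Definition nb_triples (s : nat) (z : 'I_s -> 'I_s -> 'I_s -> bool) : nat :=
  \sum_(i < s) \sum_(j < s) \sum_(k < s) ((i < j < k) && exactly z i j k).

Section TriplePoints.
Variables (K : fieldType) (s : nat) (f : 'I_s -> line K) (v : 'I_s -> 'rV[K]_3).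
Hypothesis vn0 : forall i, (v i != 0)%R.
Hypothesis fv : forall i, normal_to (f i) (v i).
Hypothesis finj : injective f.

Let z i j k := det3 (v i) (v j) (v k) == 0%R.

Let cross_n0 i j : i != j -> (cross (v i) (v j) != 0)%R.
Proof. by move=> ij; apply: (normal_cross _ _ (@fv i) (@fv j)); rewrite ?(inj_eq finj). Qed.

Let on_two P i j : i != j -> incident P (f i) -> incident P (f j) ->
  exists2 a, a != 0%R & val P = <[a *: cross (v i) (v j)]>%VS.
Proof.
move=> ij; have [p p0 Pp] := point_vec P.
rewrite !(incident_dot Pp (@fv _)) => /eqP pi /eqP pj.
have [a e] := orthogonal_cross (cross_n0 ij) pi pj.
by exists a; rewrite -?e //; apply: contraNneq p0 => a0; rewrite e a0 scale0r.
Qed.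

Let incident_third P i j k : i != j -> incident P (f i) -> incident P (f j) ->
  incident P (f k) = z i j k.
Proof.
move=> ij Pi Pj; have [a a0 e] := on_two ij Pi Pj.
by rewrite (incident_dot e (@fv k)) dotZl mulf_eq0 (negbTE a0).
Qed.

Let meet_point i j : i != j -> exists P, incident P (f i) && incident P (f j).
Proof.
move=> ij; exists (point_of (cross_n0 ij)).
rewrite !(@incident_dot _ (point_of _) _ (cross (v i) (v j)) _ erefl (@fv _)).
by rewrite dot_crossl dot_crossr eqxx.
Qed.

Let eq_on_two P Q i j : i != j -> incident P (f i) -> incident P (f j) ->
  incident Q (f i) -> incident Q (f j) -> P = Q.
Proof.
move=> ij Pi Pj Qi Qj; have [a a0 eP] := on_two ij Pi Pj.
have [b b0 eQ] := on_two ij Qi Qj.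
have lin (c d : K) (u : 'rV[K]_3) : c != 0%R -> d != 0%R -> (<[c *: u]> <= <[d *: u]>)%VS.
  move=> c0 d0; rewrite -memvE; apply/vlineP; exists (c / d)%R.
  by rewrite scalerA divfK.
by apply/val_inj; rewrite /= eP eQ; apply/eqP; rewrite eqEsubv !lin.
Qed.

Let thr P : {set 'I_s} := [set i | incident P (f i)].

Let L : arrangement K := [fset f i | i in 'I_s]%fset.

Let card_thr P : #|` lines_through L P| = #|thr P|.
Proof.
have -> : lines_through L P = [fset f i | i in thr P]%fset.
  apply/fsetP => l; rewrite !inE; apply/andP/imfsetP.
    by case=> /imfsetP[i _ ->] Pi; exists i; rewrite //= inE.
  by case=> i /=; rewrite inE => Pi ->; split=> //; apply/imfsetP; exists i.
by rewrite card_imfset //= -cardE.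
Qed.

Let S := [set t : 'I_s * 'I_s * 'I_s |
  (t.1.1 < t.1.2 < t.2) && exactly z t.1.1 t.1.2 t.2].
Let g (t : 'I_s * 'I_s * 'I_s) : {set 'I_s} := [set t.1.1; t.1.2; t.2].

Let g_inj : {in S &, injective g}.
Proof.
move=> [[i j] k] [[i' j'] k']; rewrite !inE /= => /andP[/andP[ij jk] _] /andP[/andP[ij' jk'] _] e.
have srt (a b c : 'I_s) : a < b -> b < c -> sorted (fun x y : 'I_s => x < y) [:: a; b; c].
  by move=> ab bc; rewrite /= ab bc.
suff [-> -> ->] : [:: i; j; k] = [:: i'; j'; k'] by [].
apply: irr_sorted_eq (srt _ _ _ ij jk) (srt _ _ _ ij' jk') _.
- by move=> b a c; apply: ltn_trans.
- by move=> a; rewrite ltnn.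
- by move=> a; have := congr1 (fun A : {set _} => a \in A) e; rewrite /g !inE /= -!orbA.
Qed.

(** Once [P] lies on lines [i] and [j], concurrence of a line with these two is incidence with [P],
    so the combinatorial condition describes exactly which lines pass through [P]. *)
Let exactly_thr P i j k : i != j -> incident P (f i) -> incident P (f j) ->
  [&& i != k, j != k & exactly z i j k] = (i != k) && (j != k) && (thr P == [set i; j; k]).
Proof.
move=> ij Pi Pj; rewrite /exactly ij /=.
case: (eqVneq i k) => //= ik; case: (eqVneq j k) => //= jk.
rewrite -(incident_third k ij Pi Pj); apply/andP/eqP => [[Pk /forallP h]|e].
  apply/setP => l; rewrite !inE; have := h l; rewrite !inE.
  case: (eqVneq l i) => [->//|_]; case: (eqVneq l j) => [->//|_].
  case: (eqVneq l k) => [->//|_] /=; rewrite negb_or => /andP[+ _].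
  by rewrite -(incident_third l ij Pi Pj) => /negbTE.
have Pk : incident P (f k).
  by have := congr1 (fun A : {set _} => k \in A) e; rewrite !inE eqxx !orbT.
split=> //; apply/forallP => l; apply/implyP; rewrite !inE => nl.
rewrite -(incident_third l ij Pi Pj) -(incident_third l ik Pi Pk) -(incident_third l jk Pj Pk) !orbb.
have := congr1 (fun A : {set _} => l \in A) e; rewrite !inE => ->.
by rewrite -orbA.
Qed.

Let triple_thr P : #|thr P| = 3 -> exists2 t, t \in S & thr P = g t.
Proof.
move=> c3.
have : sorted (fun x y : 'I_s => x < y) (enum (thr P)).
  rewrite {1}/enum_mem -enumT.
  apply: sorted_filter; first by move=> b a c; apply: ltn_trans.
  have := iota_ltn_sorted 0 s; rewrite -val_enum_ord.
  by rewrite sorted_map.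
have : thr P =i enum (thr P) by move=> i; rewrite mem_enum.
have : size (enum (thr P)) = 3 by rewrite -cardE.
case: (enum _) => [|i [|j [|k []]]] //= _ e /and3P[ij jk _].
have eg : thr P = [set i; j; k] by apply/setP => l; rewrite e !inE orbA.
exists (i, j, k) => //; rewrite inE /= ij jk /=.
have [nij njk nik] : [/\ i != j, j != k & i != k].
  by rewrite -!val_eqE /= !ltn_eqF // (ltn_trans ij jk).
have Pi : incident P (f i) by have := e i; rewrite !inE eqxx.
have Pj : incident P (f j) by have := e j; rewrite !inE eqxx orbT.
by have := exactly_thr k nij Pi Pj; rewrite nik njk /= eg eqxx => ->.
Qed.

(** Triple points inject into 3-element index sets by [thr], since two lines determine their common
    point. Increasing triples inject by [g], and the two images coincide. *)
Lemma t3_nb_triples : t3 L = nb_triples z.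
Proof.
transitivity #|S|.
  rewrite /t3; set A := fset_set _.
  have AE P : (P \in A) = (#|thr P| == 3).
    rewrite /A in_fset_set; last exact: finite_triple_points.
    by rewrite -card_thr; apply/idP/eqP; rewrite inE.
  have -> : #|` A| = #|` [fset thr P | P in A]%fset|.
    rewrite card_in_imfset //= => P Q; rewrite !AE => /eqP/triple_thr[[[i j] k] tS eP] _ e.
    have ij : i != j by move: tS; rewrite inE /= => /andP[/andP[ij _] _]; rewrite -val_eqE /= ltn_eqF.
    have iP : i \in thr P by rewrite eP !inE eqxx.
    have jP : j \in thr P by rewrite eP !inE eqxx orbT.
    have iQ : i \in thr Q by rewrite -e.
    have jQ : j \in thr Q by rewrite -e.
    by move: iP jP iQ jQ; rewrite !inE; apply: eq_on_two.
  have -> : [fset thr P | P in A]%fset = [fset g t | t in S]%fset.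
    apply/fsetP => B; apply/imfsetP/imfsetP => /=.
      by case=> P; rewrite AE => /eqP/triple_thr[t tS e] ->; exists t.
    case=> -[[i j] k] tS ->; have := tS; rewrite inE /= => /andP[/andP[ij jk] ex].
    have nij : i != j by rewrite -val_eqE /= ltn_eqF.
    have [P /andP[Pi Pj]] := meet_point nij.
    have := exactly_thr k nij Pi Pj; rewrite ex andbT.
    have nik : i != k by rewrite -val_eqE /= ltn_eqF // (ltn_trans ij jk).
    have njk : j != k by rewrite -val_eqE /= ltn_eqF.
    rewrite nik njk => /esym/eqP e; exists P => //; rewrite AE e.
    by rewrite -finset.setUA cardsU1 cards2 !inE negb_or nij nik njk.
  by rewrite card_in_imfset //= -cardE.
rewrite -sum1_card big_mkcond /= /nb_triples !pair_big /=.
by apply: eq_bigr => -[[i j] k] _; rewrite inE /=; case: ifP.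
Qed.

End TriplePoints.

(** * Arrangements as families of vectors *)

Definition vec_concurrent (K : fieldType) s (v : 'I_s -> 'rV[K]_3) i j k :=
  det3 (v i) (v j) (v k) == 0%R.

Definition distinct_lines (K : fieldType) s (v : 'I_s -> 'rV[K]_3) :=
  (forall i, v i != 0%R) /\ forall i j, i != j -> cross (v i) (v j) != 0%R.

Lemma has_arrangementP s t : has_arrangement s t <->
  exists (K : fieldType) (v : 'I_s -> 'rV[K]_3),
    distinct_lines v /\ nb_triples (vec_concurrent v) = t.
Proof.
split=> [[K [L [sL tL]]]|[K [v [[n0 nC] <-]]]].
  have hn (l : line K) : exists u : 'rV[K]_3, u != 0%R /\ normal_to l u.
    by have [u u0 lu] := exists_normal l; exists u.
  have [n nP] := boolp.choice hn.
  subst s; exists K; pose f (i : 'I_(#|` L|)) := tnth (in_tuple (enum_fset L)) i.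
  have finj : injective f by apply/tuple_uniqP; exact: fset_uniq.
  exists (n \o f); have n0 i : (n \o f) i != 0%R by have [] := nP (f i).
  have nf i : normal_to (f i) ((n \o f) i) by have [] := nP (f i).
  split.
    split=> // i j ij; apply: normal_cross (n0 i) (n0 j) (nf i) (nf j) _.
    by rewrite (inj_eq finj).
  rewrite -tL /vec_concurrent -(t3_nb_triples n0 nf finj); congr t3.
  apply/fsetP => l; apply/imfsetP/idP => [[i _ ->]|lL]; first exact: mem_tnth.
  by have /tnthP[i ->] : l \in in_tuple (enum_fset L) by []; exists i.
pose f i := line_of (n0 i).
have fv i : normal_to (f i) (v i) by exact: normal_line_of.
have finj : injective f.
  move=> i j e; apply/eqP; apply: contraT => /nC /negP[]; apply/eqP.
  (* The vector [cross (v i) w] lies in the plane of [f i], which is that of [f j], so it is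
     orthogonal to [v j]. Basis vectors in place of [w] then annihilate [cross (v i) (v j)]. *)
  have h w : det3 (v i) (v j) w = 0%R.
    apply/eqP; rewrite -oppr_eq0 -det3_swap /det3 -(fv j) -e fv dot_crossl //.
  by apply/rV3P; rewrite [RHS]mxE;
    [rewrite -(h (vec3 1 0 0)%R)|rewrite -(h (vec3 0 1 0)%R)|rewrite -(h (vec3 0 0 1)%R)];
    rewrite det3E !vec3E; ring.
exists K, [fset f i | i in 'I_s]%fset; split; last exact: t3_nb_triples.
by rewrite card_imfset //= -cardE card_ord.
Qed.

(** * Valencies in a partial Steiner triple system *)

Section Counting.
Variables (s : nat) (E : 'I_s -> 'I_s -> 'I_s -> bool).
Hypothesis E_C : forall i j k, E j i k = E i j k.
Hypothesis E_swap : forall i j k, E i k j = E i j k.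
Hypothesis E_neq : forall i j k, E i j k -> i != j.
Hypothesis E_fun : forall i j k k', E i j k -> E i j k' -> k = k'.

Definition valency (i : 'I_s) := \sum_(j < s) \sum_(k < s) ((j < k) && E i j k).

Let E_neqs i j k : E i j k -> [/\ (i : nat) != j, (i : nat) != k & (j : nat) != k].
Proof.
move=> e; rewrite !val_eqE (E_neq e); split => //.
  by apply: E_neq (j) _; rewrite E_swap.
by apply: E_neq (i) _; rewrite E_swap E_C.
Qed.

(** Each triple is seen from each of its three members. The three summands below correspond to [i]
    being its smallest, middle or largest element. *)
Lemma sum_valency :
  \sum_i valency i = 3 * \sum_(i < s) \sum_(j < s) \sum_(k < s) ((i < j < k) && E i j k).
Proof.
set N := (X in 3 * X).
pose A (i j k : 'I_s) : nat := (i < j < k) && E i j k.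
transitivity (\sum_(i < s) \sum_(j < s) \sum_(k < s) (A i j k + A j i k + A j k i)).
  rewrite /valency; apply: eq_bigr => i _; apply: eq_bigr => j _; apply: eq_bigr => k _.
  rewrite /A E_C (E_swap j i k) E_C; case e: (E i j k); last by rewrite !andbF.
  by have [] := E_neqs e; rewrite !andbT; lia.
transitivity (N + N + N); last lia.
under eq_bigr => i _ do under eq_bigr => j _ do rewrite !big_split /=.
under eq_bigr => i _ do rewrite !big_split /=.
rewrite !big_split /=; congr (_ + _ + _); first by rewrite exchange_big.
rewrite exchange_big /=; apply: eq_bigr => j _; exact: exchange_big.
Qed.

Let sum_third_le i j : \sum_(k < s) E i j k <= (j != i).
Proof.
case: (boolP [exists k, E i j k]) => [/existsP[k e]|/existsPn h]; last first.
  by rewrite big1 // => k _; rewrite (negbTE (h k)).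
have [+ _ _] := E_neqs e; rewrite val_eqE eq_sym => ->.
rewrite (bigD1 k) //= e big1 ?addn0 // => k' /negP nk.
by case e': (E i j k') => //; case: nk; rewrite (E_fun e e').
Qed.

Let valency2 i : 2 * valency i = \sum_(j < s) \sum_(k < s) E i j k.
Proof.
rewrite mul2n -addnn {2}/valency exchange_big -big_split /=.
apply: eq_bigr => j _; rewrite -big_split /=; apply: eq_bigr => k _.
rewrite (E_swap i j k); case e: (E i j k); last by rewrite !andbF.
by have [] := E_neqs e; rewrite !andbT; lia.
Qed.

Let sum_neq (i : 'I_s) : \sum_(j < s) (j != i) = s.-1.
Proof.
transitivity #|predC1 i|; last by rewrite cardC1 card_ord.
by rewrite -sum1_card [RHS]big_mkcond; apply: eq_bigr => j _; rewrite inE; case: (_ == _).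
Qed.

(** The triples through [i] are disjoint away from [i], so they pair off some of the s - 1 other
    elements. *)
Lemma valency_le i : valency i <= s.-1./2.
Proof.
rewrite geq_half_double -mul2n valency2 -(sum_neq i).
by apply: leq_sum => j _; apply: sum_third_le.
Qed.

Lemma nb_triples_le :
  3 * \sum_(i < s) \sum_(j < s) \sum_(k < s) ((i < j < k) && E i j k) <= s * s.-1./2.
Proof.
rewrite -sum_valency -[X in _ <= X * _](card_ord s) -sum_nat_const.
by apply: leq_sum => i _; apply: valency_le.
Qed.

(** The triples through [i] cover s - 2 elements besides [i], which leaves a single one
    uncovered. *)
Lemma unique_partner i : 2 * valency i = s - 2 -> 1 < s ->
  exists2 p, p != i & forall j, (j != i) && (j != p) = [exists k, E i j k].
Proof.
move=> v2 s2; pose A : {set 'I_s} := [set j | [exists k, E i j k]].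
have AE : #|A| = s - 2.
  rewrite -v2 valency2 -sum1_card big_mkcond /=; apply: eq_bigr => j _.
  rewrite inE; case: (boolP [exists k, E i j k]) => [/existsP[k e]|/existsPn h].
    apply/eqP; rewrite eqn_leq; apply/andP; split; first by rewrite (bigD1 k) //= e.
    by apply: leq_trans (sum_third_le i j) _; case: (_ != _).
  by rewrite big1 // => k _; rewrite (negbTE (h k)).
have iA : i \notin A by rewrite inE; apply/existsPn => k; apply/negP => /E_neq; rewrite eqxx.
have : #|~: (i |: A)| = 1 by have := cardsC (i |: A); rewrite cardsU1 iA AE card_ord; lia.
move=> /eqP/cards1P[p pE]; exists p.
  by have : p \in ~: (i |: A); [rewrite pE finset.inE | rewrite !finset.inE negb_or => /andP[]].
move=> j; have := congr1 (fun B : {set _} => j \in B) pE; rewrite /= !finset.inE => e.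
case: (eqVneq j i) e => [->|_] /= e; first by move: iA; rewrite inE => /negbTE.
by rewrite -e negbK.
Qed.

End Counting.

(** * Two closure theorems *)

Section Incidence.
Local Open Scope ring_scope.
Variable K : fieldType.
Implicit Types (o u w p q r : 'rV[K]_3).

Lemma det3Z1 k p q r : det3 (k *: p) q r = k * det3 p q r.
Proof. by rewrite !det3E !mxE; ring. Qed.
Lemma det3Z2 k p q r : det3 p (k *: q) r = k * det3 p q r.
Proof. by rewrite !det3E !mxE; ring. Qed.
Lemma det3Z3 k p q r : det3 p q (k *: r) = k * det3 p q r.
Proof. by rewrite !det3E !mxE; ring. Qed.
Definition det3Z := (det3Z1, det3Z2, det3Z3).

Lemma cramer3 o u w p :
  det3 o u w *: p = det3 p u w *: o + det3 o p w *: u + det3 o u p *: w.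
Proof. by apply: rV3P; rewrite !det3E !mxE; ring. Qed.

(** Chart with origin [o] and line at infinity through [u] and [w]: [affine_pt] is the point (y, t),
    and [direction] is the point at infinity of slope [a]. The vertical direction is [w] itself. *)
Definition affine_pt o u w (y t : K) := o + y *: u + t *: w.
Definition direction u w (a : K) := u + a *: w.

Lemma affine_ptP o u w p : det3 o u w != 0 -> det3 p u w != 0 ->
  exists k y t, k != 0 /\ p = k *: affine_pt o u w y t.
Proof.
move=> D0 p0; exists (det3 p u w / det3 o u w), (det3 o p w / det3 p u w), (det3 o u p / det3 p u w).
split; first by rewrite mulf_neq0 ?invr_neq0.
apply: (scalerI D0); rewrite cramer3 /affine_pt !(scalerDr, scalerA).
by congr (_ *: _ + _ *: _ + _ *: _); field; rewrite ?D0 ?p0.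
Qed.

Lemma directionP o u w p : det3 o u w != 0 -> det3 p u w == 0 ->
  det3 o p w != 0 -> exists k a, k != 0 /\ p = k *: direction u w a.
Proof.
move=> D0 /eqP p0 q0; exists (det3 o p w / det3 o u w), (det3 o u p / det3 o p w).
split; first by rewrite mulf_neq0 ?invr_neq0.
apply: (scalerI D0); rewrite cramer3 /direction p0 scale0r add0r !(scalerDr, scalerA).
by congr (_ *: _ + _ *: _); field; rewrite ?D0 ?q0.
Qed.

Section Chart.
Variables o u w : 'rV[K]_3.
Hypothesis D0 : det3 o u w != 0.
Local Notation D := (det3 o u w).
Local Notation pt := (affine_pt o u w).
Local Notation dir := (direction u w).

Let reduce x c : x = D * c -> (x == 0) = (c == 0).
Proof. by move=> ->; rewrite mulf_eq0 (negbTE D0). Qed.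

Lemma chart_ppp y1 t1 y2 t2 y3 t3 : (det3 (pt y1 t1) (pt y2 t2) (pt y3 t3) == 0) =
  ((y2 - y1) * (t3 - t1) - (y3 - y1) * (t2 - t1) == 0).
Proof. by apply: reduce; rewrite !det3E !mxE; ring. Qed.
Lemma chart_opp y1 t1 y2 t2 : (det3 o (pt y1 t1) (pt y2 t2) == 0) = (y1 * t2 - y2 * t1 == 0).
Proof. by apply: reduce; rewrite !det3E !mxE; ring. Qed.
Lemma chart_upp y1 t1 y2 t2 : (det3 u (pt y1 t1) (pt y2 t2) == 0) = (t1 - t2 == 0).
Proof. by apply: reduce; rewrite !det3E !mxE; ring. Qed.
Lemma chart_wpp y1 t1 y2 t2 : (det3 w (pt y1 t1) (pt y2 t2) == 0) = (y2 - y1 == 0).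
Proof. by apply: reduce; rewrite !det3E !mxE; ring. Qed.
Lemma chart_dpp a y1 t1 y2 t2 :
  (det3 (dir a) (pt y1 t1) (pt y2 t2) == 0) = (t1 - t2 + a * (y2 - y1) == 0).
Proof. by apply: reduce; rewrite !det3E !mxE; ring. Qed.
Lemma chart_odp a y t : (det3 o (dir a) (pt y t) == 0) = (t - a * y == 0).
Proof. by apply: reduce; rewrite !det3E !mxE; ring. Qed.
Lemma chart_owp y t : (det3 o w (pt y t) == 0) = (- y == 0).
Proof. by apply: reduce; rewrite !det3E !mxE; ring. Qed.
Lemma chart_oud a : (det3 o u (dir a) == 0) = (a == 0).
Proof. by apply: reduce; rewrite !det3E !mxE; ring. Qed.

End Chart.

(** The chart has [b0] as origin and the line of [a0], [a1], [a2] at infinity. The nondegeneracy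
    hypotheses keep the other b's and the c's in the affine part and [a2] away from [a1]; an
    incidence with one of the a's then becomes an equality of coordinates or of slopes. *)
Lemma pappus (a0 a1 a2 b0 b1 b2 c0 c1 c2 : 'rV[K]_3) :
  det3 b0 a0 a1 != 0 -> det3 b0 a2 a1 != 0 ->
  det3 b1 a0 a1 != 0 -> det3 b2 a0 a1 != 0 ->
  det3 c0 a0 a1 != 0 -> det3 c1 a0 a1 != 0 -> det3 c2 a0 a1 != 0 ->
  det3 a2 a0 a1 == 0 -> det3 b0 b1 b2 == 0 ->
  det3 a1 b2 c0 == 0 -> det3 a2 b1 c0 == 0 ->
  det3 a0 b2 c1 == 0 -> det3 b0 a2 c1 == 0 ->
  det3 a0 b1 c2 == 0 -> det3 b0 a1 c2 == 0 ->
  det3 c0 c1 c2 == 0.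
Proof.
move=> D0 na2 nb1 nb2 nc0 nc1 nc2 ha.
have [ka [a [ka0 ->]]] := directionP D0 ha na2.
have [k1 [y1 [t1 [k10 ->]]]] := affine_ptP D0 nb1.
have [k2 [y2 [t2 [k20 ->]]]] := affine_ptP D0 nb2.
have [l0 [z0 [s0 [l00 ->]]]] := affine_ptP D0 nc0.
have [l1 [z1 [s1 [l10 ->]]]] := affine_ptP D0 nc1.
have [l2 [z2 [s2 [l20 ->]]]] := affine_ptP D0 nc2.
rewrite !det3Z !mulf_eq0 !(negbTE ka0, negbTE k10, negbTE k20, negbTE l00, negbTE l10, negbTE l20) /=.
rewrite (chart_opp D0) => /eqP hb.
rewrite (chart_wpp D0) subr_eq0 => /eqP ->.
rewrite (chart_dpp D0) => /eqP h2.
rewrite (chart_upp D0) subr_eq0 => /eqP h3.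
rewrite (chart_odp D0) subr_eq0 => /eqP h4.
rewrite (chart_upp D0) subr_eq0 => /eqP <-.
rewrite (chart_owp D0) oppr_eq0 => /eqP ->.
rewrite (chart_ppp D0).
have -> : s0 = t1 + a * (y2 - y1) by rewrite -[LHS]addr0 -h2; ring.
(* The remaining determinant lies in the ideal generated by the three relations [h4], [hb] and
   [h3]. *)
apply/eqP; transitivity ((s1 - a * z1) * (y2 - y1) + (y1 * t2 - y2 * t1) + y1 * (s1 - t2)); first by ring.
by rewrite hb h3 h4; ring.
Qed.

(* In the affine chart with origin p0 and line at infinity p1 p2, the conclusion *)
(* says that p3 and p7 have the same slope.                                     *)
Lemma twelve_point_closure p0 p1 p2 p3 p5 p6 p7 p8 p9 p10 p11 :
  det3 p0 p1 p2 != 0 -> det3 p0 p5 p2 != 0 -> det3 p0 p1 p5 != 0 ->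
  det3 p3 p1 p2 != 0 -> det3 p6 p1 p2 != 0 -> det3 p7 p1 p2 != 0 ->
  det3 p8 p1 p2 != 0 -> det3 p9 p1 p2 != 0 -> det3 p10 p1 p2 != 0 ->
  det3 p11 p1 p2 != 0 -> det3 p0 p2 p6 != 0 ->
  det3 p5 p1 p2 == 0 -> det3 p0 p2 p11 == 0 -> det3 p1 p6 p11 == 0 ->
  det3 p0 p5 p6 == 0 -> det3 p2 p6 p8 == 0 -> det3 p3 p8 p11 == 0 ->
  det3 p5 p9 p11 == 0 -> det3 p1 p3 p9 == 0 -> det3 p0 p9 p10 == 0 ->
  det3 p5 p8 p10 == 0 -> det3 p1 p7 p10 == 0 -> det3 p2 p7 p9 == 0 ->
  det3 p0 p3 p7 == 0.
Proof.
move=> D0 n5 na n3 n6 n7 n8 n9 n10 n11 nc h5; move: na nc.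
have [k5 [a [k50 ->]]] := directionP D0 h5 n5.
have [k3 [y3 [t3 [k30 ->]]]] := affine_ptP D0 n3.
have [k6 [y6 [t6 [k60 ->]]]] := affine_ptP D0 n6.
have [k7 [y7 [t7 [k70 ->]]]] := affine_ptP D0 n7.
have [k8 [y8 [t8 [k80 ->]]]] := affine_ptP D0 n8.
have [k9 [y9 [t9 [k90 ->]]]] := affine_ptP D0 n9.
have [k10 [y10 [t10 [k100 ->]]]] := affine_ptP D0 n10.
have [k11 [y11 [t11 [k110 ->]]]] := affine_ptP D0 n11.
rewrite !det3Z !mulf_eq0 !(negbTE k50, negbTE k30, negbTE k60, negbTE k70, negbTE k80, negbTE k90, negbTE k100, negbTE k110) /=.
rewrite (chart_oud D0) => a0; rewrite (chart_owp D0) oppr_eq0 => c0.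
rewrite (chart_owp D0) oppr_eq0 => /eqP ->.
rewrite (chart_upp D0) subr_eq0 => /eqP <-.
rewrite (chart_odp D0) subr_eq0 => /eqP ->.
rewrite (chart_wpp D0) subr_eq0 => /eqP ->.
rewrite (chart_ppp D0) => /eqP A.
rewrite (chart_dpp D0) => /eqP B.
rewrite (chart_upp D0) subr_eq0 => /eqP t39; rewrite t39 in A *.
rewrite (chart_opp D0) => /eqP C.
rewrite (chart_dpp D0) => /eqP E.
rewrite (chart_upp D0) subr_eq0 => /eqP ->.
rewrite (chart_wpp D0) subr_eq0 => /eqP <-.
rewrite (chart_opp D0).
(* The identity below expresses [a * y6] times the conclusion through [A], [B], [C] and [E]. The
   factor is cancelled because [p5] is off the line [p0 p1] and [p6] is off the line [p0 p2]. *)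
have ac0 : a * y6 != 0 by rewrite mulf_neq0.
apply/eqP/(mulfI ac0); rewrite mulr0.
transitivity (t9 * (((y6 - y3) * (a * y6 - t9) - (0 - y3) * (t8 - t9))
   + y6 * (t9 - a * y6 + a * (0 - y9)) - y3 * (t8 - t10 + a * (y10 - y6)))
   - a * y3 * (y9 * t10 - y10 * t9) - y3 * t10 * (t9 - a * y6 + a * (0 - y9))); first by ring.
by rewrite A B C E; ring.
Qed.
End Incidence.

(** * Upper bounds *)

Section VecConcurrent.
Variables (K : fieldType) (s : nat) (v : 'I_s -> 'rV[K]_3).
Local Notation z := (vec_concurrent v).
Local Notation E := (exactly z).

Lemma vec_concurrentC i j k : z j i k = z i j k.
Proof. by rewrite /vec_concurrent det3C oppr_eq0. Qed.

Lemma vec_concurrent_swap i j k : z i k j = z i j k.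
Proof. by rewrite /vec_concurrent det3_swap oppr_eq0. Qed.

Lemma exactlyC i j k : E j i k = E i j k.
Proof.
rewrite /exactly (eq_sym j i) vec_concurrentC.
case: (i != j) => //=; case: (i != k) => //=; rewrite ?andbF //; case: (j != k) => //=.
congr (_ && _); apply: eq_forallb => l; rewrite !inE vec_concurrentC.
by rewrite [(l == j) || _]orbCA [z j k l || _]orbC.
Qed.

Lemma exactly_swap i j k : E i k j = E i j k.
Proof.
rewrite /exactly (eq_sym k j) vec_concurrent_swap.
case: (i != j) => //=; rewrite ?andbF //; case: (i != k) => //=; case: (j != k) => //=.
congr (_ && _); apply: eq_forallb => l; rewrite !inE (vec_concurrentC j k).
by rewrite [(l == k) || _]orbC [z i k l || _]orbCA.
Qed.

Lemma exactly_neq i j k : E i j k -> i != j.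
Proof. by case/and5P. Qed.

Lemma exactly_concurrent i j k : E i j k -> z i j k.
Proof. by case/and5P. Qed.

Lemma exactly_avoid i j k l : E i j k -> l \notin [:: i; j; k] ->
  [/\ ~~ z i j l, ~~ z i k l & ~~ z j k l].
Proof. by case/and5P=> _ _ _ _ /forallP/(_ l)/implyP h /h; rewrite !negb_or => /and3P. Qed.

Lemma exactly_fun i j k k' : E i j k -> E i j k' -> k = k'.
Proof.
move=> e e'; apply/eqP; apply: contraT => nk.
have [_ nik njk ze' _] := and5P e'.
have [] := exactly_avoid (l := k') e; last by rewrite ze'.
by rewrite !inE !(eq_sym k') !negb_or nik njk nk.
Qed.

End VecConcurrent.

(** In a subfamily there are fewer lines to avoid. The converse fails: a quadruple point may become
    triple. *)
Lemma exactly_comp (s m : nat) (z : 'I_s -> 'I_s -> 'I_s -> bool) (h : 'I_m -> 'I_s) i j k :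
  injective h -> exactly z (h i) (h j) (h k) ->
  exactly (fun a b c => z (h a) (h b) (h c)) i j k.
Proof.
move=> hinj /and5P[]; rewrite /exactly !(inj_eq hinj) => -> -> -> -> /forallP H /=.
by apply/forallP => l; have := H (h l); rewrite !inE !(inj_eq hinj).
Qed.

Lemma has_arrangement_le_schonheim s t : has_arrangement s t -> 3 * t <= s * s.-1./2.
Proof.
case/has_arrangementP=> K [v [_ <-]].
exact: (nb_triples_le (@exactlyC _ _ v) (@exactly_swap _ _ v) (@exactly_neq _ _ _) (@exactly_fun _ _ v)).
Qed.

(** The valencies have mean 3t / (s + 1), so some line has at most that many triple points. Deleting
    it destroys only these, and may create others out of quadruple points. *)
Lemma delete_line s t : has_arrangement s.+1 t ->
  exists2 t', has_arrangement s t' & s.+1 * t <= s.+1 * t' + 3 * t.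
Proof.
case/has_arrangementP=> K [v [[v0 vC] vt]].
pose E := exactly (vec_concurrent v).
pose r := @valency _ E.
have [i0 hi0] : exists i, s.+1 * r i <= 3 * t.
  have rt : \sum_i r i = 3 * t.
    by rewrite -vt; apply: sum_valency; [exact: exactlyC|exact: exactly_swap|exact: exactly_neq].
  apply/existsP; apply: contraT => /existsPn h.
  have : \sum_(i < s.+1) 3 * t < \sum_(i < s.+1) s.+1 * r i.
    rewrite [ltnRHS](bigD1 ord0) //= [ltnLHS](bigD1 ord0) //= -addSn leq_add // ?ltnNge //.
    by apply: leq_sum => i _; rewrite ltnW // ltnNge.
  by rewrite -[ltnRHS]big_distrr /= rt sum_nat_const card_ord ltnn.
pose v' i := v (lift i0 i).
exists (nb_triples (vec_concurrent v')).
  apply/has_arrangementP; exists K, v'; split=> //; split=> [i|i j ij]; first exact: v0.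
  by apply: vC; rewrite (inj_eq lift_inj).
suff : t <= nb_triples (vec_concurrent v') + r i0.
  move=> le; apply: leq_trans (_ : s.+1 * (nb_triples (vec_concurrent v') + r i0) <= _).
    by rewrite leq_mul2l.
  by rewrite mulnDr leq_add2l.
rewrite -vt /nb_triples -/E.
pose F (i j k : 'I_s.+1) : nat := (i < j < k) && E i j k.
have -> : \sum_(i < s.+1) \sum_(j < s.+1) \sum_(k < s.+1) (i < j < k) && E i j k
   = \sum_i \sum_j \sum_k F i j k by [].
have lift_le (G : 'I_s.+1 -> nat) : \sum_(i < s) G (lift i0 i) <= \sum_i G i.
  by rewrite [leqRHS](bigD1_ord i0) //= leq_addl.
(* An increasing triple has [i0] in first, second or third position, or avoids it. *)
have split1 : \sum_i \sum_j \sum_k F i j k <= \sum_(j < s.+1) \sum_(k < s.+1) F i0 j k +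
    \sum_(i < s.+1) \sum_(k < s.+1) F i i0 k + \sum_(i < s.+1) \sum_(j < s.+1) F i j i0 +
    \sum_(i < s) \sum_(j < s) \sum_(k < s) F (lift i0 i) (lift i0 j) (lift i0 k).
  rewrite (bigD1_ord i0) //= -!addnA leq_add2l.
  apply: leq_trans (_ : \sum_(i < s) (\sum_k F (lift i0 i) i0 k + (\sum_j F (lift i0 i) j i0 +
     \sum_(j < s) \sum_(k < s) F (lift i0 i) (lift i0 j) (lift i0 k))) <= _).
    apply: leq_sum => i _; rewrite (bigD1_ord i0) //= leq_add2l.
    apply: leq_trans (_ : \sum_(j < s) (F (lift i0 i) (lift i0 j) i0 +
       \sum_(k < s) F (lift i0 i) (lift i0 j) (lift i0 k)) <= _).
      by apply: leq_sum => j _; rewrite (bigD1_ord i0).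
    by rewrite big_split /= leq_add2r (lift_le (fun j => F (lift i0 i) j i0)).
  rewrite big_split /= leq_add //; first exact: (lift_le (fun i => \sum_k F i i0 k)).
  by rewrite big_split /= leq_add2r (lift_le (fun i => \sum_j F i j i0)).
apply: (leq_trans split1); rewrite addnC; apply: leq_add.
  apply: leq_sum => i _; apply: leq_sum => j _; apply: leq_sum => k _.
  rewrite /F; case: (boolP (E _ _ _)) => [e|]; last by rewrite andbF.
  have -> : exactly (vec_concurrent v') i j k by apply: exactly_comp e; exact: lift_inj.
  by rewrite !andbT /= !ltnNge !leq_bump2.
(* For given [j < k] at most one of the three positions of [i0] is increasing, so the three sums
   together are at most the valency of [i0]. *)
rewrite /r /valency -!big_split /=; apply: leq_sum => j _.
rewrite -!big_split /=; apply: leq_sum => k _.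
rewrite /F /E (exactlyC _ i0 j) (exactly_swap _ j i0 k) (exactlyC _ i0 j).
case e: (exactly _ i0 j k); rewrite ?andbF // !andbT; lia.
Qed.

(** * The search for twelve lines with twenty triple points *)

(* Labels are given to partners in consecutive pairs 2m, 2m + 1. *)
Definition flip a := if odd a then a.-1 else a.+1.

Fixpoint third (bl : seq (nat * nat * nat)) a b : option nat :=
  if bl is (x, y, w) :: bl' then
    if a == x then (if b == y then Some w else if b == w then Some y else third bl' a b)
    else if a == y then (if b == x then Some w else if b == w then Some x else third bl' a b)
    else if a == w then (if b == x then Some y else if b == y then Some x else third bl' a b)
    else third bl' a b
  else None.

Section Search.
Variables (p : 'I_12 -> 'I_12) (E : 'I_12 -> 'I_12 -> 'I_12 -> bool).

Definition closed_pappus := forall a0 a1 a2 b0 b1 b2 c0 c1 c2,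
  E a0 a1 a2 -> E b0 b1 b2 -> E a1 b2 c0 -> E a2 b1 c0 -> E a0 b2 c1 ->
  E b0 a2 c1 -> E a0 b1 c2 -> E b0 a1 c2 ->
  all (fun x => x \notin [:: a0; a1; a2]) [:: b0; b1; b2; c0; c1; c2] ->
  uniq [:: c0; c1; c2] -> E c0 c1 c2.

Definition closed_twelve := forall p0 p1 p2 p3 p5 p6 p7 p8 p9 p10 p11,
  E p1 p2 p5 -> E p0 p2 p11 -> E p1 p6 p11 -> E p0 p5 p6 -> E p2 p6 p8 ->
  E p8 p11 p3 -> E p5 p11 p9 -> E p1 p3 p9 -> E p0 p9 p10 -> E p5 p8 p10 ->
  E p1 p10 p7 -> E p2 p9 p7 ->
  all (fun x => x \notin [:: p1; p2; p5]) [:: p0; p3; p6; p7; p8; p9; p10; p11] ->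
  p6 \notin [:: p0; p2; p11] -> uniq [:: p0; p3; p7] -> E p0 p3 p7.

Hypothesis E_C : forall i j k, E j i k = E i j k.
Hypothesis E_swap : forall i j k, E i k j = E i j k.
Hypothesis E_neq : forall i j k, E i j k -> i != j.
Hypothesis E_fun : forall i j k k', E i j k -> E i j k' -> k = k'.
Hypothesis pE : forall i j, (j != i) && (j != p i) = [exists k, E i j k].
Hypothesis p_neq : forall i, p i != i.
Hypothesis pappusE : closed_pappus.
Hypothesis twelveE : closed_twelve.

(** Not meeting in a triple point is a symmetric relation, because [E] is symmetric. *)
Let pK : involutive p.
Proof.
move=> i; apply/eqP; apply: contraT => ni.
have := pE (p i) i; rewrite eq_sym p_neq eq_sym ni /= => /esym/existsP[k].
by rewrite E_C => e; have := pE i (p i); rewrite eqxx andbF => /esym/existsP[]; exists k.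
Qed.

Let E_partner i j k : E i j k -> j != p i.
Proof.
move=> e; have : [exists k, E i j k] by apply/existsP; exists k.
by rewrite -pE => /andP[].
Qed.

(** The state of the search: [g] matters only below [n], the labels in use come in partner pairs,
    and [bl] holds the triples known so far. *)
Record labelling n (bl : seq (nat * nat * nat)) (g : nat -> 'I_12) : Prop := Labelling {
  lab_even : ~~ odd n;
  lab_inj : forall a b, a < n -> b < n -> g a = g b -> a = b;
  lab_flip : forall a, a < n -> p (g a) = g (flip a);
  lab_blocks : forall x y w, (x, y, w) \in bl ->
    [/\ x < n, y < n, w < n & E (g x) (g y) (g w)] }.

Lemma flip_lt n a : ~~ odd n -> a < n -> flip a < n.
Proof. by rewrite /flip; case: ifP; lia. Qed.

Section Labelled.
Variables (n : nat) (bl : seq (nat * nat * nat)) (g : nat -> 'I_12).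
Hypothesis gP : labelling n bl g.

Lemma third_sound a b c : third bl a b = Some c ->
  [/\ a < n, b < n, c < n & E (g a) (g b) (g c)].
Proof.
have := lab_blocks gP; elim: bl => [|[[x y] w] l IH] //= h.
have {IH} IH := IH (fun x' y' w' m => h x' y' w' (mem_behead (s := _ :: _) m)).
have [xn yn wn e] := h x y w (mem_head _ _).
have e1 : E (g x) (g w) (g y) by rewrite E_swap.
have e2 : E (g y) (g x) (g w) by rewrite E_C.
have e3 : E (g y) (g w) (g x) by rewrite E_swap.
have e4 : E (g w) (g x) (g y) by rewrite E_C.
have e5 : E (g w) (g y) (g x) by rewrite E_C.
case: (a =P x) => [av|_].
  case: (b =P y) => [bv|_]; first by rewrite av bv => -[<-].
  by case: (b =P w) => [bv|_]; [rewrite av bv => -[<-]|exact: IH].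
case: (a =P y) => [av|_].
  case: (b =P x) => [bv|_]; first by rewrite av bv => -[<-].
  by case: (b =P w) => [bv|_]; [rewrite av bv => -[<-]|exact: IH].
case: (a =P w) => [av|_].
  case: (b =P x) => [bv|_]; first by rewrite av bv => -[<-].
  by case: (b =P y) => [bv|_]; [rewrite av bv => -[<-]|exact: IH].
exact: IH.
Qed.

Definition on_block a b c := third bl a b == Some c.

Lemma on_blockE a b c : on_block a b c -> E (g a) (g b) (g c).
Proof. by move=> /eqP /third_sound[]. Qed.

Lemma on_block_lt a b c : on_block a b c -> [/\ a < n, b < n & c < n].
Proof. by move=> /eqP /third_sound[]. Qed.

(** Two reasons why the lines [a], [b], [c] cannot form a triple: [a] and [b] are partners, or they
    already have another third line. *)
Definition apart a b c :=
  (b == flip a) || (if third bl a b is Some d then d != c else false).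

Lemma apart_sound a b c : a < n -> c < n -> apart a b c -> ~~ E (g a) (g b) (g c).
Proof.
move=> an cn /orP[/eqP ->|].
  by apply/negP => /E_partner; rewrite (lab_flip gP) // eqxx.
case t: third => [d|] //; have [_ _ dn e] := third_sound t.
apply: contra => e'; apply/eqP; apply: (lab_inj gP dn cn); exact: E_fun e e'.
Qed.

Definition not_block a b c := [|| apart a b c, apart a c b | apart b c a].

Lemma not_block_sound a b c : a < n -> b < n -> c < n ->
  not_block a b c -> ~~ E (g a) (g b) (g c).
Proof.
move=> an bn cn /or3P[/apart_sound|/apart_sound h|/apart_sound h]; first exact.
  by rewrite -E_swap h.
by rewrite -E_C -E_swap h.
Qed.

Lemma lab_mem a (s : seq nat) : a < n -> all (fun x => x < n) s ->
  (g a \in map g s) = (a \in s).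
Proof.
move=> an; elim: s => //= x s IH /andP[xn /IH]; rewrite !inE => ->; congr orb.
by apply/eqP/eqP => [|->//]; exact: (lab_inj gP).
Qed.

(** Four labels determine the whole configuration, so the certificate stores no more. The default 0
    of a failed lookup is harmless, since [on_block] rejects it. *)
Definition pappus_at a0 a1 b0 b1 : bool :=
  let o x y := odflt 0 (third bl x y) in
  let a2 := o a0 a1 in let b2 := o b0 b1 in
  let c0 := o a1 b2 in let c1 := o a0 b2 in let c2 := o a0 b1 in
  [&& on_block a0 a1 a2, on_block b0 b1 b2, on_block a1 b2 c0, on_block a2 b1 c0,
      on_block a0 b2 c1, on_block b0 a2 c1, on_block a0 b1 c2, on_block b0 a1 c2,
      all (fun x => x \notin [:: a0; a1; a2]) [:: b0; b1; b2; c0; c1; c2],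
      uniq [:: c0; c1; c2] & not_block c0 c1 c2].

Lemma pappus_at_sound a0 a1 b0 b1 : pappus_at a0 a1 b0 b1 -> False.
Proof.
rewrite /pappus_at; set a2 := odflt _ _; set b2 := odflt _ _.
set c0 := odflt _ _; set c1 := odflt _ _; set c2 := odflt _ _.
move=> /and5P[ha hb h1 h2 /and5P[h3 h4 h5 h6 /and3P[dj un nb]]].
have [a0n a1n a2n] := on_block_lt ha; have [b0n b1n b2n] := on_block_lt hb.
have [_ _ c0n] := on_block_lt h1; have [_ _ c1n] := on_block_lt h3.
have [_ _ c2n] := on_block_lt h5.
case/negP: (not_block_sound c0n c1n c2n nb); apply: (pappusE (on_blockE ha) (on_blockE hb)
  (on_blockE h1) (on_blockE h2) (on_blockE h3) (on_blockE h4) (on_blockE h5) (on_blockE h6)).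
  apply/allP => x; rewrite -[[:: g b0; _; _; _; _; _]]/(map g [:: b0; b1; b2; c0; c1; c2]).
  case/mapP => y yl ->; rewrite -[[:: g a0; _; _]]/(map g [:: a0; a1; a2]).
  rewrite lab_mem /= ?a0n ?a1n ?a2n //; first exact: (allP dj).
  by move: yl; rewrite !inE => /or4P[||| /or3P[]] /eqP ->.
rewrite -[[:: g c0; _; _]]/(map g [:: c0; c1; c2]) map_inj_in_uniq // => x y.
by rewrite !inE => /or3P[] /eqP -> /or3P[] /eqP ->; exact: (lab_inj gP).
Qed.

Definition twelve_at p0 p1 p2 : bool :=
  let o x y := odflt 0 (third bl x y) in
  let p5 := o p1 p2 in let p11 := o p0 p2 in let p6 := o p0 p5 in
  let p8 := o p2 p6 in let p3 := o p8 p11 in let p9 := o p5 p11 in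
  let p10 := o p0 p9 in let p7 := o p1 p10 in
  [&& on_block p1 p2 p5, on_block p0 p2 p11, on_block p1 p6 p11, on_block p0 p5 p6 &
  [&& on_block p2 p6 p8, on_block p8 p11 p3, on_block p5 p11 p9, on_block p1 p3 p9 &
  [&& on_block p0 p9 p10, on_block p5 p8 p10, on_block p1 p10 p7, on_block p2 p9 p7 &
  [&& all (fun x => x \notin [:: p1; p2; p5]) [:: p0; p3; p6; p7; p8; p9; p10; p11],
      p6 \notin [:: p0; p2; p11], uniq [:: p0; p3; p7] & not_block p0 p3 p7]]]].

Lemma twelve_at_sound p0 p1 p2 : twelve_at p0 p1 p2 -> False.
Proof.
rewrite /twelve_at; set p5 := odflt _ _; set p11 := odflt _ _; set p6 := odflt _ _.
set p8 := odflt _ _; set p3 := odflt _ _; set p9 := odflt _ _.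
set p10 := odflt _ _; set p7 := odflt _ _.
move=> /and5P[h1 h2 h3 h4 /and5P[h5 h6 h7 h8 /and5P[h9 ha hb hc /and4P[dj p6n un nb]]]].
have [p1n p2n p5n] := on_block_lt h1; have [p0n _ p11n] := on_block_lt h2.
have [_ _ p6lt] := on_block_lt h4; have [_ _ p8n] := on_block_lt h5.
have [_ _ p3n] := on_block_lt h6; have [_ _ p9n] := on_block_lt h7.
have [_ _ p10n] := on_block_lt h9; have [_ _ p7n] := on_block_lt hb.
case/negP: (not_block_sound p0n p3n p7n nb); apply: (twelveE (on_blockE h1) (on_blockE h2)
  (on_blockE h3) (on_blockE h4) (on_blockE h5) (on_blockE h6) (on_blockE h7) (on_blockE h8)
  (on_blockE h9) (on_blockE ha) (on_blockE hb) (on_blockE hc)).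
- apply/allP => x; rewrite -[[:: g p0; _; _; _; _; _; _; _]]/(map g [:: p0; p3; p6; p7; p8; p9; p10; p11]).
  case/mapP => y yl ->; rewrite -[[:: g p1; _; _]]/(map g [:: p1; p2; p5]).
  rewrite lab_mem /= ?p1n ?p2n ?p5n //; first exact: (allP dj).
  by move: yl; rewrite !inE => /or4P[||| /or4P[||| /orP[]]] /eqP ->.
- by rewrite -[[:: g p0; _; _]]/(map g [:: p0; p2; p11]) lab_mem //= p0n p2n p11n.
rewrite -[[:: g p0; _; _]]/(map g [:: p0; p3; p7]) map_inj_in_uniq // => x y.
by rewrite !inE => /or3P[] /eqP -> /or3P[] /eqP ->; exact: (lab_inj gP).
Qed.

Definition excluded a b c :=
  let clash x y := if third bl x c is Some d then d != y else false in
  [|| c == a, c == b, c == flip a, c == flip b, clash a b | clash b a].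

Lemma excluded_sound a b c : a < n -> b < n -> c < n -> excluded a b c ->
  ~~ E (g a) (g b) (g c).
Proof.
move=> an bn cn; have clash x y : x < n -> y < n ->
    (if third bl x c is Some d then d != y else false) -> ~~ E (g x) (g y) (g c).
  move=> xn yn; case t: third => [d|] //; have [_ _ dn e] := third_sound t.
  apply: contra => e'; apply/eqP; apply: (lab_inj gP dn yn); apply: E_fun e _.
  by rewrite E_swap.
case/or4P => [/eqP ->|/eqP ->|/eqP ->|/or3P[/eqP ->|/clash h|/clash h]].
- by rewrite -E_swap; apply/negP => /E_neq; rewrite eqxx.
- by rewrite -E_C -E_swap; apply/negP => /E_neq; rewrite eqxx.
- by rewrite -E_swap; apply/negP => /E_partner; rewrite (lab_flip gP) ?eqxx.
- by rewrite -E_C -E_swap; apply/negP => /E_partner; rewrite (lab_flip gP) ?eqxx.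
- exact: h.
- by rewrite -E_C; apply: h.
Qed.

Lemma add_block a b c : a < n -> b < n -> c < n -> E (g a) (g b) (g c) ->
  labelling n ((a, b, c) :: bl) g.
Proof.
move=> an bn cn e; case: gP => h1 h2 h3 h4; split=> // x y w.
by rewrite inE => /orP[/eqP[-> -> ->]|/h4].
Qed.

(** A line outside the labelled set has its partner outside too, since that set is closed under the
    involution [p]. The two receive the labels [n] and [n.+1]. *)
Lemma add_pair k : (forall a, a < n -> g a != k) ->
  exists g', labelling n.+2 bl g' /\ g' n = k /\ {in gtn n, g' =1 g}.
Proof.
move=> gk; have [ne _ _ _] := gP.
pose g' x := if x == n then k else if x == n.+1 then p k else g x.
have gE x : x < n -> g' x = g x by move=> xn; rewrite /g' !ltn_eqF // ltnW.
have gpk a : a < n -> g a != p k.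
  by move=> an; rewrite -(inv_eq pK) (lab_flip gP) // gk // flip_lt.
have gn : g' n = k by rewrite /g' eqxx.
have gn1 : g' n.+1 = p k by rewrite /g' eqxx eqn_leq ltnn.
have lt2 x : x < n.+2 -> [\/ x = n, x = n.+1 | x < n] 
  by rewrite ltnS leq_eqVlt ltnS leq_eqVlt => /or3P[/eqP->|/eqP->|]; [apply: Or32|apply: Or31|apply: Or33].
exists g'; split; [split|by split=> // x; exact: gE].
- by rewrite /= negbK.
- move=> a b /lt2[->|->|an] /lt2[->|->|bn] //; rewrite ?gn ?gn1 ?gE // => e.
  + by move: (p_neq k); rewrite -e eqxx.
  + by move: (gk b bn); rewrite -e eqxx.
  + by move: (p_neq k); rewrite e eqxx.
  + by move: (gpk b bn); rewrite -e eqxx.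
  + by move: (gk a an); rewrite e eqxx.
  + by move: (gpk a an); rewrite e eqxx.
  + exact: (lab_inj gP).
- move=> a /lt2[->|->|an]; rewrite ?gn ?gn1.
  + by rewrite /flip (negbTE ne) gn1.
  + by rewrite /flip /= ne gn pK.
  + by rewrite !gE ?flip_lt //; exact: (lab_flip gP).
- move=> x y w /(lab_blocks gP)[xn yn wn e].
  by rewrite !gE // !(ltn_trans _ (ltnSn _)) // ltnW.
Qed.

Lemma fresh_line : n < 12 -> exists k, forall a, a < n -> g a != k.
Proof.
move=> n12; pose A : {set 'I_12} := [set g (val a) | a in 'I_n].
have : 0 < #|~: A|.
  have An : #|A| <= n by apply: leq_trans (leq_imset_card _ _) _; rewrite card_ord.
  by have := cardsC A; rewrite card_ord; lia.
case/card_gt0P => k; rewrite inE => kA; exists k => a an.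
by apply: contraNneq kA => <-; apply/imsetP; exists (Ordinal an).
Qed.

Lemma all_labelled k : 12 <= n -> exists2 a, a < n & g a = k.
Proof.
move=> n12; have ginj : injective (fun a : 'I_12 => g a).
  by move=> a b /(lab_inj gP) e; apply/val_inj/e; apply: leq_trans n12.
have [h _ hK] := injF_bij ginj; exists (h k); last exact: hK.
exact: leq_trans (ltn_ord _) n12.
Qed.

End Labelled.

(* [Split a b cs] branches on the label of the third line through the triple     *)
(* point of a and b: one subtree for each admissible old label in increasing     *)
(* order, then, if fewer than 12 labels are in use, one for a fresh label.       *)
Inductive cert :=
  | Fresh of cert
  | Split of nat & nat & seq cert
  | Pappus of nat & nat & nat & nat
  | Twelve of nat & nat & nat.

(** Recursion is on [fuel] because [cert] is nested inside [seq]; exhausted fuel counts as failure.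
    A [Split] with no children closes a branch in which no third label is admissible. *)
Fixpoint refute fuel (c : cert) n bl : bool :=
  if fuel is fuel'.+1 then
    match c with
    | Fresh c' => (n < 12) && refute fuel' c' n.+2 bl
    | Split a b cs =>
      let old := [seq x <- iota 0 n | ~~ excluded bl a b x] in
      let next := [seq (n, x) | x <- old] ++ (if n < 12 then [:: (n.+2, n)] else [::]) in
      [&& a < n, b < n, a != b, b != flip a, size cs == size next &
        all (fun q => refute fuel' q.1 q.2.1 ((a, b, q.2.2) :: bl)) (zip cs next)]
    | Pappus a0 a1 b0 b1 => pappus_at bl a0 a1 b0 b1
    | Twelve p0 p1 p2 => twelve_at bl p0 p1 p2
    end
  else false.

Lemma refute_sound fuel c n bl g : labelling n bl g -> refute fuel c n bl -> False.
Proof.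
elim: fuel c n bl g => [|fuel IH] //= [c|a b cs|a0 a1 b0 b1|p0 p1 p2] n bl g gP; last 2 first.
- by move=> h; exact: (pappus_at_sound gP h).
- by move=> h; exact: (twelve_at_sound gP h).
- case/andP=> n12; have [k gk] := fresh_line g n12.
  by have [g' [gP' _]] := add_pair gP gk; exact: IH gP'.
set old := [seq _ <- _ | _]; set next := _ ++ _ => /and5P[an bn ab fab /andP[/eqP sz H]].
have step m x g' : (m, x) \in next -> labelling m ((a, b, x) :: bl) g' -> False.
  move=> mx gP'; pose i := index (m, x) next.
  have iz : i < size next by rewrite index_mem.
  have := all_nthP (Fresh (Pappus 0 0 0 0), (0, 0)) H i.
  rewrite size_zip sz minnn => /(_ iz); rewrite nth_zip //= nth_index //=.
  exact: IH gP'.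
(* The line [b] is neither [a] nor its partner, so the two meet in a triple point. *)
have : [exists k, E (g a) (g b) k].
  rewrite -pE (lab_flip gP) //; apply/andP; split; apply/eqP => /(lab_inj gP) e.
    by case/eqP: ab; rewrite e.
  by case/eqP: fab; rewrite e // flip_lt // (lab_even gP).
case/existsP=> k e.
(* The third line either carries a label, which then cannot be excluded, or is new; in the latter
   case fewer than 12 labels are in use and it receives the label [n]. *)
case: (boolP [exists x : 'I_n, g x == k]) => [/existsP[x /eqP xk]|/existsPn nk].
  have e' : E (g a) (g b) (g x) by rewrite xk.
  apply: (step n x g); last exact: add_block.
  rewrite mem_cat; apply/orP; left; apply/mapP; exists (val x) => //.
  rewrite mem_filter mem_iota /= add0n ltn_ord andbT.
  by apply/negP => /(excluded_sound gP an bn (ltn_ord x)); rewrite e'.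
case: (ltnP n 12) => n12; last first.
  by have [x xn /eqP gx] := all_labelled gP k n12; have := nk (Ordinal xn); rewrite gx.
have gk x : x < n -> g x != k by move=> xn; exact: (nk (Ordinal xn)).
have [g' [gP' [gn ge]]] := add_pair gP gk.
apply: (step n.+2 n g'); first by rewrite /next n12 mem_cat inE eqxx orbT.
by apply: add_block => //; rewrite ?gn ?ge ?inE // ltnW // ltnW.
Qed.

Lemma refute_empty fuel c : refute fuel c 0 [::] -> False.
Proof. by apply: (@refute_sound _ _ _ _ (fun=> ord0)). Qed.

End Search.

(* Found by computer, preferring pairs of labels with few admissible thirds. *)
Definition twelve_cert : cert :=
  Fresh (Fresh (Split 0 2 [:: Split 0 3 [:: Split 1 2 [:: Split 1 3 [:: Fresh (Split 0 6 [:: Split 0 7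
  [:: Split 1 6 [:: Split 2 6 [:: Split 0 10 [::]]; Split 0 10 [::]]; Split 0 9 [:: Split 1 6 [::
  Split 1 10 [:: Split 1 7 [:: Split 2 6 [:: Split 3 6 [:: Split 4 6 [::]]; Split 3 6 [:: Split 4 6
  [::]]]]]; Split 1 9 [:: Split 1 8 [:: Split 2 6 [:: Split 3 6 [:: Split 4 6 [::]]; Split 3 6 [::
  Split 4 6 [::]]]]]; Split 1 7 [:: Split 1 9 [:: Split 2 6 [:: Split 3 6 [:: Split 4 6 [::]]; Split 3
  6 [:: Split 4 6 [::]]]]; Split 2 6 [:: Split 1 8 [:: Split 2 10 [::]]; Split 2 9 [::]]]]]]]); Split
  0 6 [:: Split 0 7 [:: Split 1 9 [:: Split 3 9 [:: Split 0 10 [::]]; Split 0 10 [::]]; Split 0 9 [::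
  Split 2 7 [:: Split 2 11 [:: Split 2 9 [:: Split 1 9 [:: Split 3 10 [:: Split 4 6 [::]; Split 1 10
  [::]]; Split 3 7 [:: Split 3 9 [::]; Split 4 7 [::]]]]]; Split 1 9 [:: Split 1 10 [:: Split 4 10 [::
  Split 3 9 [::]; Split 2 10 [::]]]; Split 3 9 [:: Split 5 10 [:: Split 5 9 [::]; Split 3 10 [::]]]];
  Split 2 8 [:: Split 2 6 [:: Split 1 10 [:: Split 3 11 [:: Split 4 6 [::]; Split 1 11 [::]]; Split 3
  9 [:: Split 3 10 [::]; Split 4 9 [::]]]]]]]]]]; Split 0 6 [:: Split 0 7 [:: Split 2 9 [:: Split 5 6
  [:: Split 0 10 [::]]; Split 0 10 [::]]; Split 0 9 [:: Split 2 9 [:: Split 2 10 [:: Split 2 7 [::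
  Split 5 6 [:: Split 5 7 [:: Split 5 8 [:: Split 1 8 [:: Split 3 11 [:: Split 1 11 [::]; Pappus 1 2
  11 5]; Split 4 11 [:: Split 1 11 [::]; Pappus 1 2 11 5]]]; Split 1 5 [:: Split 1 8 [:: Split 4 8 [::
  Split 3 11 [:: Split 4 6 [:: Split 3 4 [:: Split 1 7 [:: Pappus 2 7 9 6]; Pappus 0 2 10 6]]]]; Split
  3 8 [:: Split 4 11 [:: Split 1 10 [:: Twelve 1 0 6; Split 3 10 [:: Pappus 0 6 10 3]]]]]]]; Split 5
  10 [:: Split 5 7 [:: Split 1 8 [:: Split 1 11 [:: Split 3 11 [::]]; Split 1 11 [:: Split 3 8 [::]];
  Split 3 8 [:: Split 3 11 [::]]]]]]]]; Split 2 10 [:: Split 2 8 [:: Split 5 6 [:: Split 5 8 [:: Split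
  5 7 [:: Split 1 7 [:: Split 3 11 [:: Split 1 11 [::]; Pappus 1 2 11 5]; Split 4 11 [:: Split 1 11
  [::]; Pappus 1 2 11 5]]]; Split 1 5 [:: Pappus 2 8 5 9]]; Split 5 9 [:: Split 5 7 [:: Split 1 7 [::
  Split 1 11 [:: Split 3 11 [::]]; Split 1 11 [:: Split 3 7 [::]]; Split 3 7 [:: Split 3 11
  [::]]]]]]]; Split 2 5 [:: Split 5 6 [:: Split 5 10 [:: Split 5 7 [:: Split 6 10 [:: Split 4 10 [::
  Split 1 9 [:: Split 1 7 [:: Pappus 2 9 5 1; Split 3 7 [:: Pappus 0 7 1 9]]]]; Split 3 6 [:: Split 3
  10 [:: Split 3 7 [:: Pappus 2 9 5 1; Split 4 8 [:: Split 1 3 [::]; Pappus 0 3 11 8]]]]]]]; Split 5 9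
  [:: Split 5 7 [:: Split 1 10 [:: Split 4 10 [:: Split 3 9 [:: Split 1 8 [:: Pappus 2 10 5 1; Split 1
  4 [:: Split 3 8 [:: Pappus 0 7 8 3]]]]]; Split 3 10 [:: Split 4 9 [:: Split 3 6 [:: Split 1 3 [::
  Split 4 7 [:: Pappus 4 9 3 1]; Pappus 2 10 5 1]]]]]]]]]]; Split 2 5 [:: Split 2 8 [:: Split 5 9 [::
  Split 5 8 [:: Split 5 6 [:: Split 6 9 [:: Split 4 9 [:: Split 4 6 [:: Split 4 8 [:: Pappus 1 2 10 5;
  Split 3 7 [:: Split 1 8 [::]; Pappus 0 2 7 3]]]]; Split 3 6 [:: Split 1 10 [:: Split 1 8 [:: Pappus
  1 2 10 5; Split 3 8 [:: Pappus 0 6 1 4]]]]]]]; Split 5 11 [:: Split 5 8 [:: Pappus 2 8 5 9]]]];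
  Split 2 7 [:: Split 5 10 [:: Split 5 7 [:: Split 5 6 [:: Split 1 9 [:: Split 4 9 [:: Split 3 6 [::
  Split 4 10 [:: Split 1 4 [:: Pappus 1 2 9 5; Split 3 11 [:: Pappus 3 6 4 1]]]]]; Split 3 9 [:: Split
  4 6 [:: Split 1 7 [:: Pappus 1 2 9 5; Split 1 3 [:: Split 3 7 [:: Pappus 0 9 7 3]]]]]]]]; Split 5 11
  [:: Split 5 7 [:: Split 1 9 [:: Split 4 9 [:: Split 3 6 [:: Split 1 7 [:: Twelve 1 0 11; Split 3 7
  [:: Pappus 0 9 7 3]]]]; Split 3 9 [:: Split 4 6 [:: Split 3 11 [:: Split 3 4 [:: Pappus 0 3 7 2;
  Split 1 10 [:: Pappus 5 10 8 11]]]]]]]]]]; Split 2 7 [:: Split 5 6 [:: Split 5 7 [:: Split 5 8 [::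
  Split 1 9 [:: Split 1 10 [:: Split 4 9 [:: Pappus 2 9 5 1]]; Split 1 8 [:: Split 1 10 [::]; Pappus 1
  2 0 9]]]]; Split 5 8 [:: Split 5 7 [:: Split 1 9 [:: Split 3 10 [:: Split 1 10 [::]; Pappus 2 9 5
  8]; Split 4 10 [:: Split 1 10 [::]; Pappus 2 9 5 8]]]]]]]]]]]]; Split 0 5 [:: Split 2 7 [:: Split 2
  5 [:: Split 1 5 [:: Split 1 4 [:: Split 3 4 [:: Fresh (Split 0 8 [:: Split 1 8 [:: Split 2 8
  [::]]]); Split 0 8 [:: Split 1 8 [:: Split 2 8 [::]]]]; Split 0 8 [:: Split 2 8 [:: Split 5 8
  [::]]]]; Split 0 9 [:: Split 5 9 [:: Split 5 10 [::]; Split 2 9 [::]]]]; Split 0 8 [:: Split 0 9 [::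
  Split 2 11 [:: Split 2 9 [:: Split 7 9 [:: Split 7 10 [:: Split 7 8 [:: Split 3 8 [:: Split 3 4 [::
  Split 1 11 [:: Split 3 5 [:: Split 4 8 [:: Split 5 6 [:: Twelve 2 3 6]]]]]; Split 1 8 [:: Split 4 11
  [:: Split 3 11 [:: Pappus 2 11 3 8]]]]]]; Split 7 10 [:: Split 7 8 [:: Split 3 8 [:: Split 3 9 [::
  Pappus 2 5 3 10]; Split 1 8 [:: Split 4 11 [:: Split 3 11 [:: Pappus 2 11 3 8]]]]]]]]]]]]; Split 0 8
  [:: Split 0 9 [:: Split 2 11 [:: Split 7 11 [:: Split 4 11 [:: Split 5 11 [:: Split 6 8 [:: Split 3
  8 [:: Split 1 4 [:: Split 4 9 [:: Split 7 9 [::]]; Split 1 7 [:: Split 4 7 [::]]; Split 1 7 [::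
  Split 4 7 [::]]]]]]; Split 5 11 [:: Split 6 8 [:: Split 3 8 [:: Split 1 5 [:: Split 2 5 [:: Split 2
  6 [:: Split 1 3 [:: Split 1 7 [:: Split 3 9 [:: Pappus 0 5 3 10]]; Pappus 2 11 3 8]]]; Split 2 5 [::
  Split 2 6 [:: Split 4 6 [:: Split 1 9 [:: Pappus 2 11 3 8; Split 4 7 [:: Pappus 2 6 1 7]]]]]]]]]];
  Split 3 11 [:: Split 6 11 [:: Split 5 8 [:: Split 3 8 [:: Split 1 3 [:: Split 3 9 [:: Split 7 9
  [::]]; Split 1 7 [:: Split 3 7 [::]]; Split 1 7 [:: Split 3 7 [::]]]]]]; Split 5 11 [:: Split 5 8
  [:: Split 4 8 [:: Split 2 5 [:: Split 2 6 [:: Split 1 6 [:: Split 1 4 [:: Split 4 9 [:: Pappus 0 2 1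
  9]; Pappus 2 11 4 8]]]; Split 2 6 [:: Split 3 5 [:: Split 4 9 [:: Pappus 2 11 4 8; Split 3 7 [::
  Split 1 4 [::]; Pappus 0 9 3 7]]]]]]]]]]; Split 1 2 [:: Split 2 9 [:: Split 6 9 [:: Split 6 10 [::
  Split 6 8 [:: Pappus 0 8 2 5]]; Split 6 10 [:: Split 6 8 [:: Split 5 8 [:: Split 3 5 [:: Split 1 10
  [:: Split 7 11 [:: Split 1 11 [:: Split 3 8 [:: Pappus 1 8 3 11]]; Pappus 2 7 10 6]]]; Split 1 5 [::
  Split 3 10 [:: Split 7 9 [:: Pappus 0 5 2 9; Split 1 9 [:: Pappus 6 9 7 10]]]]]]]]]; Split 2 6 [::
  Split 6 9 [:: Split 5 9 [:: Split 5 10 [:: Split 5 6 [:: Split 1 6 [:: Split 7 9 [:: Split 3 10 [::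
  Split 1 8 [:: Split 3 7 [:: Pappus 2 11 3 8]; Pappus 6 9 1 10]]]]]]; Split 6 11 [:: Split 3 9 [::
  Split 5 6 [:: Split 1 5 [:: Split 3 8 [:: Split 1 8 [::]; Pappus 2 11 3 7]]]]; Pappus 0 9 6 2]];
  Split 5 8 [:: Split 3 5 [:: Split 1 10 [:: Split 7 10 [:: Split 4 7 [:: Split 3 9 [::]; Pappus 0 2 7
  10]]; Split 4 10 [:: Split 3 9 [:: Split 1 3 [:: Split 3 8 [:: Pappus 0 5 3 8]; Twelve 1 0 7]]]]];
  Split 1 5 [:: Split 1 3 [:: Split 1 7 [:: Split 3 11 [::]]; Split 3 11 [:: Split 7 11 [::]]; Split 1
  7 [:: Split 7 11 [::]]]]]]]; Split 2 6 [:: Split 6 10 [:: Split 5 6 [:: Split 5 8 [:: Split 5 9 [::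
  Split 3 10 [:: Split 6 8 [:: Split 7 11 [:: Split 1 3 [:: Split 1 8 [::]; Pappus 0 5 1 3]; Pappus 0
  2 6 11]]]]]; Split 1 6 [:: Split 1 8 [:: Split 4 8 [:: Split 3 4 [:: Split 3 11 [::]; Pappus 0 3 4
  11]]; Split 3 8 [:: Split 4 11 [:: Split 1 7 [:: Split 7 9 [:: Pappus 0 2 7 10]; Twelve 1 0 4]]]]]];
  Split 5 8 [:: Split 3 5 [:: Split 1 6 [:: Split 1 9 [:: Split 1 3 [:: Split 3 8 [:: Split 4 9 [::
  Pappus 6 10 8 3]]]]; Split 4 6 [:: Split 3 8 [:: Split 4 11 [:: Split 1 9 [:: Split 3 4 [:: Pappus 6
  10 1 9]; Pappus 2 7 1 6]]]]]]; Split 1 5 [:: Split 1 3 [:: Split 1 7 [:: Split 3 11 [::]]; Split 3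
  11 [:: Split 7 11 [::]]; Split 1 7 [:: Split 7 11 [::]]]]]]]]; Split 1 2 [:: Split 2 9 [:: Split 5 9
  [:: Split 5 10 [:: Split 5 8 [:: Pappus 0 9 5 6]]; Split 5 10 [:: Split 5 8 [:: Split 3 8 [:: Split
  4 8 [:: Split 1 6 [:: Split 3 9 [:: Split 1 9 [:: Split 4 10 [:: Pappus 1 6 4 3]]; Pappus 2 7 3
  10]]]; Split 1 8 [:: Split 4 6 [:: Split 3 11 [:: Pappus 0 3 5 8; Split 1 11 [:: Pappus 2 11 3
  8]]]]]]]]]; Split 2 5 [:: Split 5 9 [:: Split 5 6 [:: Split 5 8 [:: Split 6 8 [:: Split 6 9 [::
  Pappus 0 8 6 2]]]; Split 1 5 [:: Split 1 8 [:: Split 3 11 [:: Split 4 8 [::]; Pappus 5 6 3 7]; Split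
  3 8 [:: Split 4 11 [:: Split 4 6 [:: Pappus 2 11 4 8; Split 1 6 [::]]]]]]]; Split 6 8 [:: Split 4 6
  [:: Split 1 10 [:: Split 1 5 [:: Split 1 4 [:: Split 7 10 [:: Pappus 0 5 1 9]]]; Split 4 9 [:: Split
  3 10 [::]; Pappus 2 5 7 4]]]; Split 1 6 [:: Split 1 4 [:: Split 1 7 [:: Split 4 11 [::]]; Split 4 11
  [:: Split 7 11 [::]]; Split 1 7 [:: Split 7 11 [::]]]]]]]; Split 2 5 [:: Split 5 10 [:: Split 5 6
  [:: Split 5 8 [:: Split 6 8 [:: Split 1 8 [:: Split 6 9 [:: Split 4 10 [:: Split 1 4 [:: Pappus 0 2
  6 9; Split 3 11 [:: Pappus 2 7 4 1]]]]]]]; Split 1 5 [:: Split 1 8 [:: Split 3 11 [:: Split 4 8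
  [::]; Pappus 5 6 3 7]; Split 1 6 [:: Split 1 3 [:: Split 3 8 [:: Pappus 0 3 1 5]]]]]]; Split 6 8 [::
  Split 4 6 [:: Split 1 9 [:: Split 1 5 [:: Split 1 4 [:: Split 3 5 [:: Split 4 10 [:: Pappus 5 10 1
  9]]]]; Split 4 10 [:: Split 3 9 [::]; Pappus 2 5 7 4]]]; Split 1 6 [:: Split 1 4 [:: Split 1 7 [::
  Split 4 11 [::]]; Split 4 11 [:: Split 7 11 [::]]; Split 1 7 [:: Split 7 11 [::]]]]]]]]]]]]; Split 0
  7 [:: Split 2 9 [:: Split 2 5 [:: Split 2 7 [:: Split 5 9 [:: Split 1 5 [:: Split 3 7 [:: Split 1 3
  [:: Split 1 4 [:: Split 4 8 [:: Split 0 10 [::]]; Split 0 10 [::]]; Split 0 10 [::]]; Split 0 10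
  [::]]; Split 0 10 [::]]; Split 0 10 [::]]; Split 0 10 [::]]; Split 2 6 [:: Split 1 5 [:: Split 1 6
  [:: Split 1 7 [:: Split 3 7 [:: Split 3 8 [:: Split 0 10 [::]]; Split 0 10 [::]]; Split 0 10 [::]];
  Split 0 10 [::]]; Split 3 5 [:: Split 4 6 [:: Split 1 3 [:: Split 1 7 [:: Split 3 7 [:: Split 0 10
  [::]]; Split 0 10 [::]]; Split 1 4 [:: Split 3 4 [:: Split 0 10 [::]]; Split 0 10 [::]]; Split 1 4
  [:: Split 3 4 [:: Split 0 10 [::]]; Split 0 10 [::]]; Split 0 10 [::]]; Split 0 10 [::]]; Split 0 10
  [::]]; Split 0 10 [::]]; Split 0 10 [::]]; Split 0 10 [::]]; Split 5 6 [:: Split 2 6 [:: Split 1 2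
  [:: Split 3 5 [:: Split 4 6 [:: Split 1 9 [:: Split 1 4 [:: Split 3 4 [:: Split 0 10 [::]]; Split 0
  10 [::]]; Split 0 10 [::]]; Split 0 10 [::]]; Split 0 10 [::]]; Split 0 10 [::]]; Split 0 10 [::]];
  Split 0 10 [::]]; Split 5 6 [:: Split 2 5 [:: Split 1 2 [:: Split 3 5 [:: Split 1 9 [:: Split 1 3
  [:: Split 3 4 [:: Split 4 6 [:: Split 0 10 [::]]; Split 0 10 [::]]; Split 0 10 [::]]; Split 0 10
  [::]]; Split 0 10 [::]]; Split 0 10 [::]]; Split 0 10 [::]]; Split 0 10 [::]]; Split 0 10 [::]];
  Split 0 9 [:: Split 2 8 [:: Split 2 7 [:: Split 2 11 [:: Split 2 9 [:: Split 6 8 [:: Split 8 10 [::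
  Split 7 8 [:: Split 4 10 [:: Split 4 11 [:: Split 4 7 [:: Split 5 10 [:: Pappus 0 2 7 8]]]]]]; Split
  4 6 [:: Split 4 10 [:: Split 1 10 [:: Split 4 9 [:: Split 4 8 [:: Split 5 11 [:: Pappus 0 3 11
  8]]]]]; Split 1 6 [:: Split 5 9 [:: Split 5 10 [::]]]]]]]; Split 2 10 [:: Split 2 6 [:: Split 5 6
  [:: Split 5 9 [:: Split 5 7 [:: Split 1 7 [:: Split 3 11 [:: Split 1 11 [::]; Pappus 5 6 3 8]; Split
  1 9 [:: Split 1 3 [:: Split 4 9 [:: Split 4 11 [:: Pappus 2 6 4 7]]]]]]]; Split 1 6 [:: Split 1 9
  [:: Split 1 10 [::]; Split 3 10 [:: Split 3 9 [::]; Split 4 10 [::]]]; Split 4 6 [:: Split 4 10 [::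
  Split 8 10 [::]; Pappus 0 2 6 9]]]]]; Split 2 5 [:: Split 5 7 [:: Split 5 6 [:: Split 3 5 [:: Split
  8 10 [:: Split 1 10 [:: Split 3 9 [:: Split 6 8 [:: Pappus 0 5 10 6]]]]]]; Split 1 7 [:: Split 7 8
  [:: Split 6 8 [:: Split 3 8 [:: Split 4 11 [:: Split 1 3 [:: Split 1 11 [:: Split 5 6 [:: Twelve 0 1
  6]]]]]]]; Split 4 7 [:: Split 6 8 [:: Split 3 11 [:: Pappus 0 5 11 4]]]]]]]; Split 7 8 [:: Split 4 7
  [:: Split 5 7 [:: Split 2 5 [:: Split 2 9 [:: Split 1 9 [:: Split 4 9 [:: Split 6 11 [:: Pappus 2 7
  9 6; Pappus 0 9 6 2]]; Split 1 10 [:: Split 5 10 [::]; Split 1 3 [:: Split 3 5 [::]]]]]; Split 2 6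
  [:: Split 1 9 [:: Split 3 10 [:: Split 4 9 [::]]; Split 3 9 [:: Split 3 10 [::]]]]]]; Split 1 7 [::
  Split 8 10 [:: Split 6 8 [:: Split 1 11 [:: Split 3 4 [::]; Split 3 4 [::]]]; Split 4 8 [:: Split 4
  6 [:: Split 1 11 [:: Split 1 9 [:: Split 2 10 [:: Split 2 6 [:: Split 5 6 [:: Pappus 2 7 4
  6]]]]]]]]]]; Split 3 8 [:: Split 6 8 [:: Split 4 11 [:: Split 3 4 [:: Split 3 11 [:: Split 1 3 [::
  Split 4 6 [:: Split 5 7 [:: Split 2 5 [:: Pappus 0 5 7 11; Split 1 5 [:: Pappus 3 5 2 8]]]]]]];
  Split 1 11 [:: Split 1 3 [:: Split 3 5 [:: Split 5 7 [::]]; Split 1 7 [::]]]]]; Split 6 8 [:: Split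
  2 6 [:: Split 2 9 [:: Split 5 11 [:: Split 4 11 [:: Split 5 10 [:: Split 1 10 [:: Pappus 6 8 1
  5]]]]]; Split 4 6 [:: Split 4 11 [::]; Split 1 6 [:: Split 1 11 [::]]]]]]]]; Split 2 10 [:: Split 2
  9 [:: Split 2 7 [:: Split 5 7 [:: Split 3 5 [:: Split 5 6 [:: Split 8 10 [:: Split 7 8 [:: Split 3
  11 [:: Split 1 8 [::]; Pappus 0 2 8 3]]]]; Split 5 6 [:: Split 6 9 [:: Split 1 11 [:: Split 4 6
  [::]; Pappus 2 9 1 8]; Split 1 9 [:: Split 7 9 [::]]]]]; Split 5 10 [:: Split 1 5 [:: Split 6 11 [::
  Split 1 6 [:: Split 7 9 [:: Split 1 7 [:: Pappus 2 7 1 6]]]]]]]]; Split 2 5 [:: Split 6 11 [:: Split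
  4 6 [:: Split 5 6 [:: Split 9 10 [:: Split 1 9 [:: Split 3 5 [:: Split 1 3 [:: Split 1 7 [:: Split 4
  7 [:: Pappus 2 9 1 11]]; Pappus 0 3 1 5]]]]]; Split 5 10 [:: Split 8 10 [::]; Split 5 6 [::]]];
  Split 1 6 [:: Split 5 9 [:: Split 5 7 [::]; Split 6 9 [::]]; Split 5 6 [:: Split 5 9 [:: Split 4 9
  [:: Split 3 10 [:: Split 3 4 [:: Split 4 7 [:: Pappus 0 2 8 3]; Pappus 0 3 4 10]]]]]]]]]; Split 2 9
  [:: Split 2 7 [:: Split 5 7 [:: Split 3 5 [:: Split 5 6 [:: Split 7 9 [:: Split 3 7 [:: Split 6 9
  [:: Split 1 6 [:: Split 1 8 [:: Split 3 10 [:: Twelve 0 1 8]; Split 3 11 [:: Twelve 7 0 9]]]]]]];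
  Split 5 6 [:: Split 6 11 [:: Split 4 6 [:: Split 4 11 [:: Split 1 4 [:: Pappus 0 2 1 11]]]; Split 1
  11 [:: Pappus 0 9 6 8]]]]; Split 5 9 [:: Split 1 5 [:: Split 6 11 [:: Split 1 6 [:: Split 1 7 [::
  Split 7 8 [::]; Pappus 2 10 1 8]]]]]; Split 3 9 [:: Split 6 9 [:: Split 3 7 [:: Split 3 5 [:: Split
  1 5 [:: Split 1 10 [:: Pappus 6 9 7 1; Pappus 0 7 1 6]]]; Split 4 10 [:: Split 1 7 [::]; Pappus 0 3
  8 10]]]; Split 4 9 [:: Split 6 10 [:: Split 4 10 [:: Split 5 6 [:: Split 1 5 [:: Split 1 7 [:: Split
  3 4 [:: Pappus 1 5 9 4]; Pappus 0 5 1 6]]]]]]]]]; Split 1 2 [:: Split 6 11 [:: Split 5 6 [:: Split 5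
  9 [:: Split 5 7 [:: Split 3 11 [:: Split 6 9 [:: Split 1 9 [:: Split 3 7 [:: Split 1 8 [:: Pappus 0
  5 1 3]; Pappus 6 11 9 3]]]]]]; Split 8 11 [:: Split 1 6 [:: Split 5 11 [:: Split 1 5 [:: Split 1 7
  [:: Split 1 8 [::]; Pappus 0 5 1 6]]]]; Pappus 0 9 6 8]]; Split 5 7 [:: Split 3 5 [:: Split 1 3 [::
  Split 1 8 [:: Split 3 10 [::]]; Split 3 10 [:: Split 8 10 [::]]; Split 1 8 [:: Split 8 10 [::]]]];
  Split 1 5 [:: Split 1 6 [:: Split 6 9 [:: Split 3 9 [:: Split 4 10 [:: Pappus 0 2 9 10]]]; Split 4 6
  [:: Split 3 9 [:: Split 1 3 [:: Split 1 7 [:: Pappus 2 10 1 8]; Twelve 3 2 10]]]]]]]]]; Split 1 2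
  [:: Split 2 7 [:: Split 5 10 [:: Split 5 7 [:: Split 5 6 [:: Split 3 9 [:: Split 4 9 [:: Split 1 6
  [:: Split 1 7 [:: Pappus 2 10 7 4; Split 3 7 [:: Twelve 3 2 9]]]]; Split 1 9 [:: Split 4 6 [:: Split
  1 10 [:: Split 1 4 [:: Pappus 0 7 1 2; Split 3 11 [:: Pappus 5 6 8 1]]]]]]]]; Split 5 11 [:: Split 5
  7 [:: Split 3 9 [:: Split 4 9 [:: Split 1 6 [:: Split 3 7 [:: Pappus 0 3 5 9; Split 1 7 [:: Split 1
  8 [:: Pappus 0 7 1 2]]]]]; Split 1 9 [:: Split 4 6 [:: Split 3 7 [:: Pappus 0 3 5 9; Split 1 3 [::
  Split 1 7 [:: Pappus 2 9 7 1]]]]]]]]]]; Split 2 5 [:: Split 5 7 [:: Split 7 9 [:: Split 3 9 [::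
  Split 5 9 [:: Split 1 5 [:: Split 7 8 [:: Split 1 8 [:: Pappus 0 5 1 7]]]]]]; Split 3 5 [:: Split 3
  9 [:: Split 3 10 [:: Split 4 7 [:: Pappus 0 2 8 3; Split 3 7 [::]]]]; Split 1 5 [:: Split 6 9 [::
  Split 6 10 [::]]]]]]; Split 2 5 [:: Split 5 11 [:: Split 6 11 [:: Split 5 9 [:: Split 6 9 [::];
  Split 1 5 [:: Split 1 6 [::]]]]; Split 5 9 [:: Split 3 5 [:: Split 6 9 [:: Split 1 6 [:: Split 3 9
  [:: Split 1 7 [:: Pappus 0 7 9 6; Split 3 8 [:: Split 1 3 [::]; Pappus 0 5 3 7]]]]]]; Split 1 5 [::
  Split 6 10 [:: Split 1 6 [:: Split 3 10 [:: Split 3 11 [:: Split 1 3 [:: Split 4 9 [:: Pappus 0 3 4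
  9]]; Pappus 0 7 3 9]]]]]]]]]]; Split 2 11 [:: Split 2 5 [:: Split 2 9 [:: Split 5 10 [:: Split 3 10
  [:: Split 6 10 [:: Split 6 11 [:: Split 1 6 [:: Split 4 8 [:: Split 1 3 [:: Split 3 8 [:: Split 5 11
  [:: Twelve 2 3 11]]]]]]]; Split 4 10 [:: Split 6 11 [:: Split 1 8 [:: Pappus 2 5 8 4]]]]; Split 5 11
  [:: Split 1 5 [:: Split 6 9 [:: Split 3 9 [:: Split 1 7 [:: Split 6 11 [:: Pappus 0 9 6 2]]]]]]]];
  Split 2 6 [:: Split 5 6 [:: Split 5 10 [:: Split 5 7 [:: Split 6 9 [:: Split 6 8 [:: Split 3 11 [::
  Split 4 8 [:: Split 3 8 [::]; Pappus 0 3 10 8]]]]]]; Split 5 7 [:: Split 3 5 [:: Split 6 8 [:: Split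
  4 6 [:: Split 8 10 [:: Split 1 4 [:: Pappus 0 3 10 8]]]; Split 1 6 [:: Split 8 10 [:: Split 1 3 [::
  Split 4 10 [:: Pappus 0 2 1 9]]]]]]; Split 1 5 [:: Split 7 11 [:: Split 1 7 [:: Split 1 6 [:: Split
  6 8 [::]; Pappus 2 7 1 5]]]]]]]; Split 2 6 [:: Split 5 6 [:: Split 5 9 [:: Split 5 7 [:: Split 3 7
  [:: Split 1 9 [:: Split 4 7 [::]; Pappus 5 7 1 9]; Split 1 7 [:: Split 4 9 [:: Split 4 6 [:: Split 1
  4 [::]; Pappus 0 9 4 7]]]]]; Split 3 5 [:: Split 7 11 [:: Split 6 11 [:: Pappus 0 9 7 8]]]]; Split 7
  11 [:: Split 4 11 [:: Split 3 8 [:: Split 3 5 [:: Split 3 4 [:: Split 6 8 [:: Pappus 0 3 10 2]]];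
  Split 4 6 [:: Split 1 8 [::]; Pappus 0 5 10 4]]]; Split 3 11 [:: Split 1 5 [:: Split 1 7 [:: Split 3
  7 [::]]; Split 3 5 [:: Split 3 7 [::]]; Split 1 7 [:: Split 3 5 [::]]]]]]]]; Split 1 2 [:: Split 2 9
  [:: Split 5 6 [:: Split 5 7 [:: Split 3 5 [:: Split 7 11 [:: Pappus 0 7 2 5; Split 6 11 [:: Split 1
  11 [:: Split 1 9 [:: Pappus 0 9 1 2]]]]]; Split 1 5 [:: Split 7 11 [:: Pappus 0 7 2 5; Split 1 7 [::
  Split 1 11 [:: Pappus 5 6 1 11; Split 3 11 [::]]]]]]; Split 6 9 [:: Split 6 8 [:: Split 1 5 [::
  Split 1 9 [:: Split 3 9 [::]]; Split 1 9 [:: Split 3 5 [::]]; Split 3 5 [:: Split 3 9 [::]]]]]]];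
  Split 2 6 [:: Split 5 6 [:: Split 6 9 [:: Split 5 7 [:: Split 7 9 [::]; Split 3 5 [:: Split 3 9
  [::]]]]; Split 5 7 [:: Split 3 5 [:: Split 9 10 [:: Split 1 10 [:: Split 3 9 [:: Split 3 8 [::
  Pappus 2 7 10 4; Split 1 6 [:: Split 1 3 [::]; Pappus 2 11 1 10]]]]]]; Split 1 5 [:: Split 7 9 [::
  Split 1 7 [:: Split 3 9 [:: Split 1 6 [:: Split 1 3 [:: Split 4 10 [:: Pappus 1 2 10 4]]; Pappus 2 7
  1 5]]]]]]]]; Split 2 6 [:: Split 5 6 [:: Split 5 7 [:: Split 5 9 [:: Split 3 9 [:: Split 1 7 [::
  Split 4 9 [::]; Pappus 5 9 1 7]; Split 1 9 [:: Split 3 10 [:: Split 1 3 [:: Pappus 1 2 5 3]]]]];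
  Split 3 5 [:: Split 9 10 [:: Split 1 9 [:: Split 6 10 [:: Split 3 8 [:: Pappus 0 2 8 10; Split 1 8
  [:: Split 4 6 [:: Pappus 0 5 11 4]]]]]]]]; Split 8 10 [:: Split 4 10 [:: Split 1 5 [:: Split 1 9 [::
  Split 3 9 [::]]; Split 1 9 [:: Split 3 5 [::]]; Split 3 5 [:: Split 3 9 [::]]]]; Split 3 10 [::
  Split 3 8 [:: Split 3 5 [:: Split 1 5 [:: Split 1 6 [:: Pappus 5 6 3 8; Pappus 0 3 1 5]]]; Split 4 6
  [:: Split 1 8 [::]; Pappus 0 5 11 4]]]]]]]; Split 1 2 [:: Split 2 9 [:: Split 5 6 [:: Split 5 10 [::
  Split 5 7 [:: Split 1 6 [:: Split 1 10 [:: Split 4 10 [::]]; Split 1 10 [:: Split 4 6 [::]]; Split 4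
  6 [:: Split 4 10 [::]]]]]; Split 5 9 [:: Split 5 7 [:: Pappus 0 9 5 6]; Split 3 5 [:: Split 3 7 [::
  Split 1 9 [:: Split 3 9 [::]; Pappus 0 3 5 9]; Split 4 9 [:: Split 3 9 [::]; Pappus 0 3 5 9]]]]]];
  Split 2 5 [:: Split 5 6 [:: Split 5 9 [:: Split 5 7 [:: Split 7 9 [:: Split 1 7 [:: Split 6 9 [::
  Split 4 6 [:: Split 1 8 [:: Split 1 4 [:: Pappus 1 2 6 4]; Split 3 11 [:: Twelve 2 3 4]]]]]]]; Split
  3 5 [:: Split 3 7 [:: Split 4 7 [:: Split 1 11 [:: Pappus 0 9 7 8]]; Split 1 7 [:: Split 4 11 [::
  Split 1 4 [:: Pappus 0 2 1 11]]]]]]; Split 7 9 [:: Split 4 9 [:: Split 4 6 [:: Split 4 7 [:: Split 3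
  4 [:: Split 6 8 [:: Pappus 0 7 8 4]]]; Pappus 0 2 6 9]]; Split 3 9 [:: Split 1 5 [:: Split 1 7 [::
  Split 3 7 [::]]; Split 3 5 [:: Split 3 7 [::]]; Split 1 7 [:: Split 3 5 [::]]]]]]]; Split 2 5 [::
  Split 5 6 [:: Split 5 10 [:: Split 6 8 [:: Split 8 10 [::]; Split 4 6 [:: Split 4 10 [::]]]]; Split
  6 8 [:: Split 4 6 [:: Split 9 10 [:: Split 1 9 [:: Split 4 10 [:: Split 3 8 [:: Split 1 3 [:: Split
  4 7 [:: Twelve 8 0 2]; Split 5 7 [:: Twelve 0 1 3]]]]]]]; Split 1 6 [:: Split 8 10 [:: Split 1 8 [::
  Split 4 10 [:: Split 3 9 [:: Split 1 3 [:: Split 4 7 [:: Twelve 6 7 11]; Split 1 4 [:: Pappus 1 2 9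
  3]]]]]]]]]]]]; Split 6 8 [:: Split 3 8 [:: Split 7 8 [:: Split 4 7 [:: Split 4 11 [:: Split 4 9 [::
  Split 6 10 [:: Split 1 10 [:: Split 1 11 [:: Pappus 2 8 7 1; Split 2 11 [::]]]]]]; Split 2 7 [::
  Split 3 7 [:: Split 3 11 [:: Split 1 5 [:: Pappus 0 5 1 11; Split 1 4 [::]]]]; Split 1 7 [:: Split 3
  11 [:: Split 1 5 [:: Split 1 2 [:: Pappus 0 9 7 2]; Pappus 0 5 1 7]]]]]]; Split 4 8 [:: Split 3 11
  [:: Split 3 4 [:: Split 3 5 [:: Split 4 6 [:: Split 1 4 [:: Split 1 10 [:: Split 1 2 [:: Split 2 6
  [:: Split 5 6 [:: Twelve 3 2 9]; Split 5 11 [:: Pappus 4 8 5 2]]]]]]]; Split 3 5 [:: Split 4 6 [::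
  Split 9 10 [:: Pappus 3 11 9 6]]]]; Split 6 11 [:: Split 1 11 [:: Split 4 7 [:: Split 2 7 [:: Split
  1 4 [:: Pappus 0 3 11 8; Split 3 4 [::]]]]]]]]; Split 4 8 [:: Split 4 11 [:: Split 3 4 [:: Split 4 6
  [:: Split 3 7 [:: Split 1 10 [:: Pappus 0 7 1 6; Pappus 4 6 1 7]; Split 1 3 [:: Split 5 10 [:: Split
  5 6 [:: Split 1 5 [::]; Pappus 0 3 5 10]]]]]; Split 4 6 [:: Split 6 10 [:: Split 2 6 [:: Pappus 0 3
  10 2]]]]; Split 2 6 [:: Split 6 9 [:: Split 2 9 [:: Split 2 7 [:: Split 4 9 [:: Split 5 9 [:: Pappus
  0 9 7 8]]]; Split 5 11 [:: Split 1 2 [::]; Pappus 0 2 7 11]]]; Split 5 6 [:: Split 1 2 [:: Split 1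
  11 [:: Split 2 7 [::]]; Split 1 11 [:: Split 2 5 [::]]; Split 2 5 [:: Split 5 11 [::]]]]]]]]; Split
  1 8 [:: Split 7 8 [:: Split 3 11 [:: Split 3 7 [:: Split 3 9 [:: Split 4 10 [:: Split 4 7 [:: Split
  1 7 [:: Split 2 9 [:: Pappus 2 8 3 7; Split 1 6 [:: Split 1 9 [::]; Pappus 6 8 7 1]]]]]]; Split 3 5
  [:: Split 4 7 [:: Split 2 7 [:: Split 4 9 [:: Split 1 10 [:: Split 1 2 [:: Split 1 5 [:: Pappus 1 8
  7 5]; Pappus 2 8 7 1]]]]]]]; Split 4 11 [:: Split 3 7 [:: Split 3 9 [:: Split 4 9 [::]]; Split 4 7
  [::]]]]]; Split 3 8 [:: Split 4 11 [:: Split 4 7 [:: Split 4 9 [:: Split 3 9 [:: Split 1 10 [::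
  Split 3 5 [::]; Pappus 4 7 1 6]; Split 1 3 [:: Split 5 10 [:: Split 5 7 [:: Split 1 5 [::]; Pappus 0
  7 5 9]]]]]; Split 3 4 [:: Split 3 7 [:: Split 1 3 [:: Split 2 7 [:: Split 2 9 [:: Pappus 0 5 2 11;
  Split 1 2 [:: Split 5 11 [:: Pappus 0 2 6 11]]]]]]]]; Split 2 7 [:: Split 3 7 [:: Split 2 9 [::
  Split 2 6 [:: Split 1 11 [:: Split 1 3 [:: Pappus 4 11 9 2; Split 1 4 [::]]]]; Split 5 11 [:: Split
  1 2 [::]; Pappus 0 2 6 11]]]; Split 3 7 [:: Split 1 2 [:: Split 1 11 [:: Split 2 6 [::]]; Split 1 11
  [:: Split 2 5 [::]]; Split 2 5 [:: Split 5 11 [::]]]]]]]; Split 3 8 [:: Split 3 11 [:: Split 4 7 [::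
  Split 4 9 [:: Split 6 10 [:: Pappus 0 7 8 6; Split 1 10 [:: Split 1 6 [:: Split 6 9 [::]; Pappus 3
  11 9 6]]]]; Split 1 4 [:: Split 6 10 [:: Split 6 11 [:: Split 1 6 [:: Split 1 3 [:: Pappus 0 3 1
  8]]]; Pappus 0 7 8 6]]]; Split 4 11 [:: Split 2 11 [:: Split 1 2 [:: Split 1 7 [:: Split 2 7 [::]];
  Split 2 5 [:: Split 5 7 [::]]; Split 1 7 [:: Split 2 5 [::]]]]]]]]; Split 1 8 [:: Split 4 8 [::
  Split 4 11 [:: Split 3 4 [:: Split 3 10 [:: Split 3 7 [:: Split 2 11 [:: Split 4 6 [:: Split 1 10
  [:: Split 1 2 [:: Split 5 6 [:: Twelve 4 5 9]; Split 1 5 [:: Pappus 1 8 11 5]]]]]]]; Split 4 6 [::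
  Split 2 6 [:: Split 5 6 [:: Pappus 0 3 10 2]; Split 1 6 [:: Split 1 5 [:: Pappus 0 5 1 10; Split 5
  10 [::]]]]]]; Split 3 7 [:: Split 5 11 [:: Split 2 11 [:: Split 1 7 [:: Split 1 2 [:: Split 1 4 [::
  Twelve 8 0 4]]]]; Pappus 0 5 11 4]; Split 3 5 [:: Split 1 4 [:: Split 1 10 [:: Split 4 9 [::]];
  Split 1 10 [:: Split 4 6 [::]]; Split 4 6 [:: Split 6 10 [::]]]]]]]; Split 3 8 [:: Split 4 6 [::
  Split 4 7 [:: Split 3 4 [:: Split 2 6 [:: Split 2 11 [:: Split 1 7 [:: Pappus 1 8 11 2; Split 2 7
  [::]]]; Split 1 6 [:: Split 2 11 [:: Split 5 10 [:: Pappus 0 2 6 8]]]]]]; Split 3 4 [:: Split 4 7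
  [:: Pappus 0 3 4 11]; Split 4 7 [:: Split 1 3 [:: Split 1 10 [:: Split 3 9 [::]]; Split 1 10 [::
  Split 3 5 [::]]; Split 3 5 [:: Split 5 10 [::]]]]]]]; Split 3 8 [:: Split 4 7 [:: Split 4 11 [::
  Split 2 7 [:: Split 2 11 [::]; Split 3 7 [:: Split 3 11 [::]]]]; Split 2 7 [:: Split 2 11 [:: Split
  2 6 [:: Split 3 7 [:: Split 3 11 [:: Split 1 3 [:: Split 1 4 [:: Split 5 6 [:: Pappus 6 8 3 1];
  Split 4 6 [:: Twelve 0 1 9]]]]]]]; Split 3 7 [:: Split 3 11 [:: Split 2 11 [:: Split 1 2 [:: Split 3
  9 [:: Split 1 5 [:: Split 5 6 [:: Twelve 7 6 10]; Split 1 4 [:: Pappus 1 8 3 9]]]]]]]]]]]]; Split 6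
  8 [:: Split 7 8 [:: Split 4 8 [:: Split 4 6 [:: Split 6 11 [:: Split 3 4 [:: Split 3 11 [::]; Split
  1 4 [:: Split 1 11 [::]]]]; Split 3 4 [:: Split 3 11 [:: Split 1 11 [:: Split 3 9 [:: Split 4 7 [::
  Split 1 10 [:: Split 2 6 [:: Split 2 7 [::]; Pappus 0 2 9 3]; Pappus 0 7 3 5]]]]]; Split 1 4 [::
  Split 7 11 [:: Split 1 11 [:: Split 2 7 [:: Split 6 9 [:: Split 1 9 [:: Split 3 5 [:: Pappus 0 9 5
  3]]; Pappus 0 7 9 4]]]]]]]]; Split 3 8 [:: Split 6 11 [:: Split 3 4 [:: Split 4 9 [:: Split 1 11 [::
  Split 3 11 [:: Split 3 5 [:: Split 5 7 [:: Pappus 0 5 3 11]]]; Split 3 11 [:: Split 3 7 [:: Split 1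
  9 [:: Twelve 6 7 8; Split 1 2 [:: Pappus 7 8 2 1]]]]]]; Split 1 4 [:: Split 1 2 [:: Split 1 9 [::
  Split 2 7 [::]]; Split 1 9 [:: Split 7 9 [::]]; Split 2 7 [:: Split 7 9 [::]]]]]; Split 2 6 [::
  Split 4 6 [:: Split 2 7 [:: Split 2 5 [:: Split 1 10 [:: Split 1 4 [:: Split 1 5 [::]; Pappus 0 2 1
  10]]]; Split 1 2 [:: Split 5 10 [:: Split 1 5 [:: Split 3 11 [:: Split 1 4 [:: Pappus 1 5 10 4];
  Pappus 2 7 3 8]]]]]]; Split 4 6 [:: Split 3 4 [:: Split 4 10 [::]; Pappus 0 3 11 2]]]]]]; Split 7 8
  [:: Split 3 8 [:: Split 2 7 [:: Split 7 9 [:: Split 4 7 [:: Split 3 4 [:: Split 3 5 [:: Split 1 11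
  [:: Split 1 2 [:: Pappus 0 9 1 4; Split 5 6 [:: Split 1 5 [::]; Pappus 3 8 6 1]]]]]]; Split 3 4 [::
  Split 4 10 [::]; Split 3 7 [::]]]; Split 4 7 [:: Split 3 11 [:: Split 4 11 [::]; Split 5 7 [::]];
  Split 3 7 [:: Split 3 11 [:: Split 3 4 [:: Split 1 4 [:: Split 5 11 [:: Split 5 9 [:: Split 2 5 [::
  Pappus 0 5 2 7]; Pappus 0 9 5 7]]]]]]]]]; Split 1 8 [:: Split 4 10 [:: Split 3 9 [:: Split 3 5 [::
  Split 1 4 [:: Split 4 9 [::]; Split 6 11 [::]]]; Split 1 3 [:: Split 6 11 [:: Split 5 10 [:: Split 2
  7 [:: Split 1 5 [::]; Pappus 0 5 2 7]]]]]; Split 3 10 [:: Split 2 10 [:: Split 3 9 [:: Split 3 4 [::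
  Split 1 4 [:: Split 1 2 [:: Pappus 0 2 1 8]]]]]]]]]; Split 1 8 [:: Split 4 8 [:: Split 3 7 [:: Split
  7 11 [:: Split 2 7 [:: Split 5 11 [:: Split 2 6 [:: Split 3 11 [:: Pappus 0 3 11 2]]]]]; Split 2 7
  [:: Split 5 7 [:: Split 3 5 [:: Split 2 10 [:: Split 4 9 [:: Split 1 10 [::]; Pappus 0 7 9 6]]]];
  Split 1 7 [:: Split 2 10 [:: Split 1 4 [:: Pappus 4 8 10 1; Pappus 0 2 1 7]; Split 5 9 [:: Pappus 0
  9 2 7; Pappus 0 5 2 10]]]]; Split 3 4 [:: Split 3 5 [:: Split 4 10 [:: Split 2 10 [:: Split 4 6 [::
  Split 1 11 [:: Split 1 2 [:: Split 5 6 [:: Twelve 10 0 3]; Split 5 7 [:: Twelve 0 1 2]]]]]]]; Split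
  3 5 [:: Split 4 9 [:: Split 6 9 [:: Split 7 9 [::]]; Split 1 4 [:: Split 5 11 [:: Split 1 6 [::
  Split 1 5 [:: Pappus 1 8 11 6; Split 1 7 [:: Pappus 3 9 1 11]]]]]]]]]]; Split 3 8 [:: Split 4 6 [::
  Split 4 7 [:: Split 3 4 [:: Split 2 6 [:: Split 5 6 [:: Split 1 11 [:: Split 1 10 [:: Split 1 7 [::
  Split 3 5 [:: Pappus 3 8 1 10]]; Pappus 0 9 4 3]]]; Split 1 6 [:: Split 3 11 [:: Split 5 10 [::
  Split 1 2 [:: Pappus 0 7 1 4; Split 1 3 [::]]; Pappus 0 9 4 3]]]]]]; Split 4 7 [:: Split 3 4 [::
  Split 2 7 [:: Split 5 7 [:: Split 1 11 [:: Split 1 10 [:: Pappus 0 7 1 4; Split 1 5 [:: Split 2 6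
  [:: Pappus 4 6 2 7]]]]]; Split 1 7 [:: Split 3 11 [:: Split 5 6 [:: Twelve 2 3 7; Split 1 5 [::
  Pappus 3 8 1 10]]]]]]]]]; Split 3 8 [:: Split 2 7 [:: Split 2 6 [:: Split 2 9 [:: Split 4 10 [::
  Split 1 11 [:: Pappus 3 8 2 1; Split 5 6 [:: Pappus 0 5 2 10]]]]; Split 1 2 [:: Split 4 10 [:: Split
  7 9 [:: Pappus 0 3 9 10]]]]; Split 4 7 [:: Split 3 7 [:: Split 3 11 [:: Split 3 9 [:: Split 4 10 [::
  Split 1 2 [:: Split 2 6 [::]; Pappus 3 8 2 1]]]]]]]]]]]]]]]])).

(** The fuel 40 suffices for the depth of the tree. *)
Lemma twelve_cert_correct : refute 40 twelve_cert 0 [::].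
Proof. by vm_compute. Qed.

(** * The closure theorems for twelve lines with partners *)

Section TwelveLines.
Variables (K : fieldType) (v : 'I_12 -> 'rV[K]_3) (p : 'I_12 -> 'I_12).
Local Notation z := (vec_concurrent v).
Local Notation E := (exactly z).
Hypothesis pE : forall i j, (j != i) && (j != p i) = [exists k, E i j k].

(** Points of multiplicity four or more cannot occur: of [j] and [k] at least one is not the partner
    of [i], so it meets [i] in a triple point, and the other line must be the third one there. Hence
    a vanishing determinant suffices to conclude [E]. *)
Let concurrent_exactly i j k : uniq [:: i; j; k] -> z i j k -> E i j k.
Proof.
rewrite /= !inE negb_or andbT => /andP[/andP[ij ik] jk] zijk.
have step a b : a != i -> b != i -> a != b -> a != p i -> z i a b -> E i a b.
  move=> ai bi ab ap zab.
  have /existsP[m e] : [exists m, E i a m] by rewrite -pE ai.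
  suff -> : b = m by [].
  apply/eqP; apply: contraT => bm; have [] := exactly_avoid (l := b) e; last by rewrite zab.
  by rewrite !inE !negb_or bi (eq_sym b) ab.
case: (eqVneq j (p i)) => [jp|jp]; last first.
  by apply: step => //; rewrite eq_sym.
rewrite -(exactly_swap v i j k); apply: step.
- by rewrite eq_sym.
- by rewrite eq_sym.
- by rewrite eq_sym.
- by rewrite -jp eq_sym.
- by rewrite (vec_concurrent_swap v i j k).
Qed.

Let det_exactly i j k : E i j k -> det3 (v i) (v j) (v k) == 0%R.
Proof. exact: exactly_concurrent. Qed.

Let det_avoid i j k l : E i j k -> l \notin [:: i; j; k] ->
  [/\ det3 (v l) (v i) (v j) != 0%R, det3 (v l) (v k) (v j) != 0%R,
      det3 (v i) (v k) (v l) != 0%R & det3 (v l) (v j) (v k) != 0%R].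
Proof.
move=> e /(exactly_avoid e)[h1 h2 h3].
have rot a b c : z c a b = z a b c by rewrite (vec_concurrentC v a c b) (vec_concurrent_swap v a b c).
split; rewrite -/(vec_concurrent v _ _ _) //.
- by rewrite (rot i j l).
- by rewrite (rot k j l) (vec_concurrentC v j k l).
- by rewrite (rot j k l).
Qed.

Lemma exactly_pappus : closed_pappus E.
Proof.
move=> a0 a1 a2 b0 b1 b2 c0 c1 c2 ha hb h1 h2 h3 h4 h5 h6 dj un.
have av x : x \in [:: b0; b1; b2; c0; c1; c2] -> det3 (v x) (v a0) (v a1) != 0%R.
  by move=> /(allP dj) /(det_avoid ha)[].
have av2 : det3 (v b0) (v a2) (v a1) != 0%R.
  by have [] := det_avoid ha (allP dj b0 (mem_head _ _)).
apply: concurrent_exactly un _.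
have ha' : E a2 a0 a1 by rewrite exactlyC exactly_swap.
apply: (pappus _ av2 _ _ _ _ _ (det_exactly ha') (det_exactly hb) (det_exactly h1)
  (det_exactly h2) (det_exactly h3) (det_exactly h4) (det_exactly h5) (det_exactly h6));
  by apply: av; rewrite !inE eqxx ?orbT.
Qed.

Lemma exactly_twelve : closed_twelve E.
Proof.
move=> p0 p1 p2 p3 p5 p6 p7 p8 p9 p10 p11 h1 h2 h3 h4 h5 h6 h7 h8 h9 h10 h11 h12 dj p6n un.
have av x : x \in [:: p0; p3; p6; p7; p8; p9; p10; p11] -> det3 (v x) (v p1) (v p2) != 0%R.
  by move=> /(allP dj) /(det_avoid h1)[].
have [n0 n05 n15 _] := det_avoid h1 (allP dj p0 (mem_head _ _)).
have [n6 _ _ _] := det_avoid h2 p6n.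
apply: concurrent_exactly un _.
have g1 : E p5 p1 p2 by rewrite exactlyC exactly_swap.
have g6 : E p3 p8 p11 by rewrite exactlyC exactly_swap.
have g7 : E p5 p9 p11 by rewrite exactly_swap.
have g11 : E p1 p7 p10 by rewrite exactly_swap.
have g12 : E p2 p7 p9 by rewrite exactly_swap.
apply: (twelve_point_closure n0 n05 _ _ _ _ _ _ _ _ _ (det_exactly g1) (det_exactly h2)
  (det_exactly h3) (det_exactly h4) (det_exactly h5) (det_exactly g6) (det_exactly g7)
  (det_exactly h8) (det_exactly h9) (det_exactly h10) (det_exactly g11) (det_exactly g12)).
- by rewrite -det3_rot.
1-7: by apply: av; rewrite !inE eqxx ?orbT.
by rewrite det3_rot.
Qed.

End TwelveLines.

Theorem no_twelve_twenty : ~ has_arrangement 12 20.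
Proof.
case/has_arrangementP=> K [v [_ vt]]; pose E := exactly (vec_concurrent v).
have E_C : forall i j k, E j i k = E i j k by exact: exactlyC.
have E_swap : forall i j k, E i k j = E i j k by exact: exactly_swap.
have E_neq : forall i j k, E i j k -> i != j by exact: exactly_neq.
have E_fun : forall i j k k', E i j k -> E i j k' -> k = k' by exact: exactly_fun.
(* The twelve valencies sum to 3 * 20 = 60 and none exceeds 5. *)
have val5 i : valency E i = 5.
  apply/eqP; rewrite eqn_leq (valency_le E_C E_swap E_neq E_fun) /=.
  rewrite leqNgt; apply/negP => lt5.
  have := sum_valency E_C E_swap E_neq; rewrite -/(nb_triples _) vt (bigD1 i) //=.
  have : \sum_(j < 12 | j != i) valency E j <= \sum_(j < 12 | j != i) 5.
    by apply: leq_sum => j _; exact: (valency_le E_C E_swap E_neq E_fun).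
  rewrite sum_nat_const -[#|_|]/#|predC1 i| cardC1 card_ord.
  by move: (\sum_(j < 12 | j != i) valency E j) (valency E i) lt5 => x y; lia.
have hp i : exists q, q != i /\ forall j, (j != i) && (j != q) = [exists k, E i j k].
  have [] := @unique_partner _ _ E_C E_swap E_neq E_fun i; rewrite ?val5 // => q qi qE.
  by exists q.
have [p pP] := boolp.choice hp.
have p_neq i : p i != i by have [] := pP i.
have pE i j : (j != i) && (j != p i) = [exists k, E i j k] by have [_ ->] := pP i.
exact: (refute_empty E_C E_swap E_neq E_fun pE p_neq (exactly_pappus pE) (exactly_twelve pE)
  twelve_cert_correct).
Qed.

(** * Arrangements over finite fields *)

(* R is an executable representation of K, with interpretation phi. *)
Section Model.
Variables (K : fieldType) (R : Type) (phi : R -> K) (r0 : R).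
Variables (add mul : R -> R -> R) (opp : R -> R) (zero : R -> bool).
Hypothesis phiD : {morph phi : x y / add x y >-> (x + y)%R}.
Hypothesis phiM : {morph phi : x y / mul x y >-> (x * y)%R}.
Hypothesis phiN : {morph phi : x / opp x >-> (- x)%R}.
Hypothesis phi0 : forall x, zero x = (phi x == 0%R).

Definition mcross (a b : R * R * R) : R * R * R :=
  let: (a0, a1, a2) := a in let: (b0, b1, b2) := b in
  (add (mul a1 b2) (opp (mul a2 b1)), add (mul a2 b0) (opp (mul a0 b2)),
   add (mul a0 b1) (opp (mul a1 b0))).

Definition mdot (a b : R * R * R) : R :=
  let: (a0, a1, a2) := a in let: (b0, b1, b2) := b in
  add (add (mul a0 b0) (mul a1 b1)) (mul a2 b2).

Definition mzero (a : R * R * R) := [&& zero a.1.1, zero a.1.2 & zero a.2].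

Variable w : seq (R * R * R).
Local Notation s := (size w).
Local Notation "w `_ i" := (nth (r0, r0, r0) w i).

Definition triples_mod : seq (seq nat) :=
  flatten [seq flatten [seq
      if i < j then let c := mcross w`_i w`_j in
        [seq [:: i; j; k] | k <- iota 0 s & (j < k) && zero (mdot c w`_k)]
      else [::] | j <- iota 0 s] | i <- iota 0 s].

Definition distinct_mod : bool :=
  all (fun i => ~~ mzero w`_i && all (fun j => (i < j) ==> ~~ mzero (mcross w`_i w`_j)) (iota 0 s))
    (iota 0 s).

(** Four concurrent lines would give two different triples with two common indices, so this
    condition makes every concurrent triple exact. *)
Definition no_quadruple_mod : bool :=
  let tr := triples_mod in
  all (fun t => all (fun t' => (count (mem t') t < 2) || (t == t')) tr) tr.

Definition phi3 (a : R * R * R) := vec3 (phi a.1.1) (phi a.1.2) (phi a.2).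

Let v (i : 'I_s) := phi3 w`_i.
Let z := vec_concurrent v.

Lemma phi3_cross a b : phi3 (mcross a b) = cross (phi3 a) (phi3 b).
Proof.
case: a b => [[a0 a1] a2] [[b0 b1] b2].
by apply: rV3P; rewrite !vec3E /= !phiD !phiN !phiM.
Qed.

Lemma phi3_dot a b : phi (mdot a b) = dot (phi3 a) (phi3 b).
Proof. by case: a b => [[a0 a1] a2] [[b0 b1] b2]; rewrite /dot !vec3E /= !phiD !phiM. Qed.

Lemma phi3_eq0 a : mzero a = (phi3 a == 0%R).
Proof.
rewrite /mzero !phi0; apply/and3P/eqP => [[/eqP e0 /eqP e1 /eqP e2]|e].
  by apply: rV3P; rewrite vec3E mxE.
have := (vec3_0 (phi a.1.1) (phi a.1.2) (phi a.2), vec3_1 (phi a.1.1) (phi a.1.2) (phi a.2),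
  vec3_2 (phi a.1.1) (phi a.1.2) (phi a.2)).
by rewrite -/(phi3 a) e !mxE => -[[<- <-] <-]; rewrite eqxx.
Qed.

Let zE (i j k : 'I_s) : z i j k = zero (mdot (mcross w`_i w`_j) w`_k).
Proof. by rewrite phi0 phi3_dot phi3_cross. Qed.

Lemma mem_triples_mod (i j k : 'I_s) :
  ([:: (i : nat); j : nat; k : nat] \in triples_mod) = (i < j < k) && z i j k.
Proof.
rewrite zE; apply/flatten_mapP/andP => [[a _ /flatten_mapP[b _]]|[/andP[ij jk] zijk]].
  case: ifP => // ab /mapP[c]; rewrite mem_filter => /andP[/andP[bc zz] _].
  by case=> -> -> ->; rewrite ab bc.
exists (i : nat); first by rewrite mem_iota ltn_ord.
apply/flatten_mapP; exists (j : nat); first by rewrite mem_iota ltn_ord.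
rewrite ij; apply/mapP; exists (k : nat) => //.
by rewrite mem_filter jk zijk mem_iota ltn_ord.
Qed.

Let sum_iota n (F : nat -> nat) : \sum_(i < n) F i = sumn [seq F i | i <- iota 0 n].
Proof. by rewrite sumnE big_map -(big_mkord xpredT) /index_iota subn0. Qed.

Lemma size_triples_mod :
  size triples_mod = \sum_(i < s) \sum_(j < s) \sum_(k < s) ((i < j < k) && z i j k).
Proof.
pose F i j k : nat := (i < j < k) && zero (mdot (mcross w`_i w`_j) w`_k).
transitivity (\sum_(i < s) \sum_(j < s) \sum_(k < s) F i j k); last first.
  by do 3!apply: eq_bigr => ? _; rewrite zE.
rewrite (sum_iota s (fun i => \sum_(j < s) \sum_(k < s) F i j k)) size_flatten /shape -map_comp.
congr sumn; apply: eq_map => i /=.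
rewrite (sum_iota s (fun j => \sum_(k < s) F i j k)) size_flatten /shape -map_comp.
congr sumn; apply: eq_map => j /=; rewrite (sum_iota s (F i j)) /F.
case: (i < j) => /=; last by elim: (iota 0 s) => //= a l <-.
by rewrite size_map; elim: (iota 0 s) => //= a l <-; case: (_ && _).
Qed.

(** Only increasing triples are listed, so the indices are first sorted; two of the eight sign
    patterns of comparisons contradict transitivity. *)
Lemma exists_triple_mod (i j k : 'I_s) : uniq [:: i; j; k] -> z i j k ->
  exists2 t, t \in triples_mod & t =i [:: (i : nat); j : nat; k : nat].
Proof.
have zC a b c : z b a c = z a b c by exact: vec_concurrentC.
have zS a b c : z a c b = z a b c by exact: vec_concurrent_swap.
have sorted_case (a b c : 'I_s) : a < b < c -> z a b c ->
    exists2 t, t \in triples_mod & t =i [:: (a : nat); b : nat; c : nat].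
  by move=> abc zz; exists [:: (a : nat); b : nat; c : nat]; rewrite // mem_triples_mod abc.
rewrite /= !inE negb_or andbT -!val_eqE /= => /andP[/andP[ij ik] jk] zz.
have z1 : z i k j by rewrite zS.
have z2 : z j i k by rewrite zC.
have z3 : z j k i by rewrite zS.
have z4 : z k i j by rewrite zC.
have z5 : z k j i by rewrite zC.
case: (ltngtP i j) ij => // ij _; case: (ltngtP i k) ik => // ik _; case: (ltngtP j k) jk => // jk _.
- by apply: sorted_case; rewrite ?ij.
- have [||t tT tE] := sorted_case i k j; rewrite ?ik ?jk //.
  by exists t => // x; rewrite tE !inE; do !case: (_ == _).
- by move: (ltn_trans ij jk); rewrite ltnNge ltnW.
- have [||t tT tE] := sorted_case k i j; rewrite ?ik ?ij //.
  by exists t => // x; rewrite tE !inE; do !case: (_ == _).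
- have [||t tT tE] := sorted_case j i k; rewrite ?ik ?ij //.
  by exists t => // x; rewrite tE !inE; do !case: (_ == _).
- by move: (ltn_trans jk ij); rewrite ltnNge ltnW.
- have [||t tT tE] := sorted_case j k i; rewrite ?ik ?jk //.
  by exists t => // x; rewrite tE !inE; do !case: (_ == _).
have [||t tT tE] := sorted_case k j i; rewrite ?ij ?jk //.
by exists t => // x; rewrite tE !inE; do !case: (_ == _).
Qed.

Lemma model_arrangement : distinct_mod -> no_quadruple_mod ->
  has_arrangement s (size triples_mod).
Proof.
move=> /allP dis /allP nq; apply/has_arrangementP; exists K, v; split.
  have hs (i : 'I_s) : (i : nat) \in iota 0 s by rewrite mem_iota ltn_ord.
  split=> [i|i j ij]; first by have /andP[] := dis i (hs i); rewrite phi3_eq0.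
  have lt (a b : 'I_s) : a < b -> cross (v a) (v b) != 0%R.
    have /andP[_ /allP/(_ b (hs b))/implyP h] := dis a (hs a).
    by move=> /h; rewrite phi3_eq0 phi3_cross.
  case: (ltngtP i j) ij => [ij _|ji _|/val_inj ->]; rewrite ?eqxx //; first exact: lt.
  by rewrite crossC oppr_eq0; apply: lt.
rewrite size_triples_mod /nb_triples; apply: eq_bigr => i _; apply: eq_bigr => j _.
apply: eq_bigr => k _; congr nat_of_bool; case: (boolP (i < j < k)) => //= ijk.
have /andP[ij jk] := ijk.
have [nij njk nik] : [/\ i != j, j != k & i != k].
  by rewrite -!val_eqE /= !ltn_eqF // (ltn_trans ij jk).
rewrite /exactly nij njk nik /= -/z; case: (boolP (z i j k)) => //= zijk.
have tT : [:: (i : nat); j : nat; k : nat] \in triples_mod by rewrite mem_triples_mod ijk.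
apply/forallP => l; apply/implyP; rewrite !inE !negb_or => /and3P[li lj lk].
(* A fourth line [l] through the point would yield a listed triple on [a], [b], [l], which shares
   two indices with [[:: i; j; k]] and hence equals it, although [l] is not in the latter. *)
have clash (a b : 'I_s) : a != b -> a \in [:: i; j; k] -> b \in [:: i; j; k] ->
    l != a -> l != b -> ~~ z a b l.
  move=> ab ai bi la lb; apply/negP => zabl.
  have [|t' tT' tE] := @exists_triple_mod a b l _ zabl.
    by rewrite /= !inE negb_or ab (eq_sym a l) la (eq_sym b l) lb.
  have /orP[|/eqP e] := allP (nq _ tT) _ tT'.
    rewrite ltnNge => /negP[].
    have at' : (a : nat) \in t' by rewrite tE inE eqxx.
    have bt' : (b : nat) \in t' by rewrite tE !inE eqxx orbT.
    rewrite -size_filter; apply: (@uniq_leq_size _ [:: (a : nat); b : nat]).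
      by rewrite /= inE andbT.
    move=> x; rewrite !inE mem_filter => /orP[] /eqP ->; rewrite /= ?at' ?bt' /=.
      by move: ai; rewrite !inE.
    by move: bi; rewrite !inE.
  have : (l : nat) \in t' by rewrite tE !inE eqxx !orbT.
  by rewrite -e !inE !val_eqE (negbTE li) (negbTE lj) (negbTE lk).
by rewrite !clash // ?inE ?eqxx ?orbT.
Qed.

End Model.

Section PrimeField.
Variable p : nat.
Hypothesis p_pr : prime p.

Definition mulm a b := (a * b) %% p.
(** Residues are represented by natural numbers, with [p.-1] in the role of -1. Sums are left
    unreduced, which is why [zerom] reduces before comparing. *)
Definition oppm a := (p.-1 * a) %% p.
Definition zerom a := a %% p == 0.

Let phi (a : nat) : 'F_p := (a%:R)%R.

Lemma Fp_arrangement (w : seq (nat * nat * nat)) :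
  distinct_mod 0 addn mulm oppm zerom w -> no_quadruple_mod 0 addn mulm oppm zerom w ->
  has_arrangement (size w) (size (triples_mod 0 addn mulm oppm zerom w)).
Proof.
apply: (@model_arrangement _ _ phi).
- by move=> a b; rewrite /phi natrD.
- by move=> a b; rewrite /phi /mulm Fp_nat_mod // natrM.
- move=> a; rewrite /phi /oppm Fp_nat_mod // natrM -subn1 natrB ?prime_gt0 //.
  by rewrite pchar_Fp_0 // sub0r mulN1r.
- by move=> a; rewrite /phi /zerom -(dvdn_pcharf (pchar_Fp p_pr)).
Qed.

End PrimeField.

(* An orbit of the subgroup of order 19 of a Singer cycle of PG(2, 11). *)
Definition singer11 : seq (nat * nat * nat) :=
  [:: (1, 0, 0); (0, 10, 5); (2, 3, 9); (10, 10, 3); (8, 5, 6); (7, 0, 8); (9, 0, 5);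
      (7, 5, 7); (4, 6, 2); (2, 6, 0); (8, 9, 3); (3, 7, 10); (5, 3, 6); (8, 3, 10);
      (7, 9, 10); (4, 10, 9); (1, 8, 3); (9, 3, 0); (4, 2, 3)].

(* The curve y^2 = x^3 + 1 over F_11, a cyclic group of order 12 in which three  *)
(* points are collinear when their sum is 0.                                    *)
Definition elliptic11 : seq (nat * nat * nat) :=
  [:: (0, 0, 1); (1, 7, 5); (1, 2, 8); (1, 5, 7); (1, 0, 10); (1, 9, 9); (1, 10, 0);
      (1, 9, 2); (1, 0, 1); (1, 5, 4); (1, 2, 3); (1, 7, 6)].

(* Found by computer among the unions of orbits of diag(1, 1, -1). *)
Definition thirteen7 : seq (nat * nat * nat) :=
  [:: (1, 0, 0); (1, 0, 1); (1, 0, 6); (1, 1, 0); (1, 1, 1); (1, 1, 6); (1, 2, 0);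
      (1, 4, 3); (1, 4, 4); (1, 5, 1); (1, 5, 6); (1, 6, 3); (1, 6, 4)].

(* The subgroup of order 15 of y^2 = x^3 + x + 7 over F_11, with 31 collinear     *)
(* triples, and the point (1, 2, 0), which lies on six lines tangent to the     *)
(* curve at one of the 15 points and passing through another.                   *)
Definition tangents11 : seq (nat * nat * nat) :=
  [:: (0, 0, 1); (1, 3, 2); (1, 10, 4); (1, 1, 8); (1, 5, 4); (1, 4, 8); (1, 7, 7);
      (1, 6, 8); (1, 6, 3); (1, 7, 4); (1, 4, 3); (1, 5, 7); (1, 1, 3); (1, 10, 7);
      (1, 3, 9); (1, 2, 0)].

Lemma arrangement_19_57 : has_arrangement 19 57.
Proof. exact: (@Fp_arrangement 11 isT singer11). Qed.

(** Since 3 * 57 is the number of pairs of the 19 lines, these form a Steiner triple system with 9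
    triple points on each line, and deleting one line leaves 57 - 9 = 48. *)
Lemma arrangement_18_48 : has_arrangement 18 48.
Proof. exact: (@Fp_arrangement 11 isT (take 18 singer11)). Qed.

(** The two deleted lines of the Steiner system have 9 triple points each, one of them common: 57 -
    17 = 40. *)
Lemma arrangement_17_40 : has_arrangement 17 40.
Proof. exact: (@Fp_arrangement 11 isT (take 17 singer11)). Qed.

(** A group of order 15 with three solutions of 3x = 0 has (225 - 3 * 15 + 2 * 3) / 6 = 31 unordered
    triples of distinct elements with sum 0. The extra point completes each of six tangents, which
    carry two of the 15 points, to a triple. *)
Lemma arrangement_16_37 : has_arrangement 16 37.
Proof. exact: (@Fp_arrangement 11 isT tangents11). Qed.

Lemma arrangement_13_23 : has_arrangement 13 23.
Proof. exact: (@Fp_arrangement 7 isT thirteen7). Qed.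

(** In a cyclic group of order 12 there are (144 - 3 * 12 + 2 * 3) / 6 = 19 unordered triples of
    distinct elements with sum 0. The coordinates are listed in the order z, x, y, so (0, 0, 1) is
    the point at infinity. *)
Lemma arrangement_12_19 : has_arrangement 12 19.
Proof. exact: (@Fp_arrangement 11 isT elliptic11). Qed.

(* [GF16 a b c d] is a + b t + c t^2 + d t^3 in F_2[t] / (t^4 + t + 1). *)
Inductive gf16 := GF16 of bool & bool & bool & bool.

Definition gf16_bits x := let: GF16 a b c d := x in (a, b, c, d).
Definition bits_gf16 q := let: (a, b, c, d) := q in GF16 a b c d.
Lemma gf16_bitsK : cancel gf16_bits bits_gf16. Proof. by case. Qed.
HB.instance Definition _ := Choice.copy gf16 (can_type gf16_bitsK).

Section GF16.
Local Open Scope ring_scope.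

Definition gf16_add x y :=
  let: GF16 a0 a1 a2 a3 := x in let: GF16 b0 b1 b2 b3 := y in
  GF16 (a0 + b0) (a1 + b1) (a2 + b2) (a3 + b3).

Definition gf16_mul x y :=
  let: GF16 a0 a1 a2 a3 := x in let: GF16 b0 b1 b2 b3 := y in
  let c4 := a1 * b3 + a2 * b2 + a3 * b1 in
  let c5 := a2 * b3 + a3 * b2 in
  let c6 := a3 * b3 in
  GF16 (a0 * b0 + c4) (a0 * b1 + a1 * b0 + c4 + c5)
    (a0 * b2 + a1 * b1 + a2 * b0 + c5 + c6)
    (a0 * b3 + a1 * b2 + a2 * b1 + a3 * b0 + c6).

(* x^-1 = x^14 *)
Definition gf16_inv x :=
  let x2 := gf16_mul x x in let x4 := gf16_mul x2 x2 in
  gf16_mul x2 (gf16_mul x4 (gf16_mul x4 x4)).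

Lemma gf16_addA : associative gf16_add.
Proof. by move=> [????] [????] [????]; congr GF16; apply: addrA. Qed.
Lemma gf16_addC : commutative gf16_add.
Proof. by move=> [????] [????]; congr GF16; apply: addrC. Qed.
Lemma gf16_add0 : left_id (GF16 0 0 0 0) gf16_add.
Proof. by move=> [????]; congr GF16; apply: add0r. Qed.
Lemma gf16_addN : left_inverse (GF16 0 0 0 0) id gf16_add.
Proof. by move=> [[] [] [] []]. Qed.

HB.instance Definition _ := GRing.isZmodule.Build gf16 gf16_addA gf16_addC gf16_add0 gf16_addN.

Lemma gf16_mulA : associative gf16_mul.
Proof. by move=> [a0 a1 a2 a3] [b0 b1 b2 b3] [c0 c1 c2 c3]; congr GF16; ring. Qed.
Lemma gf16_mulC : commutative gf16_mul.
Proof. by move=> [a0 a1 a2 a3] [b0 b1 b2 b3]; congr GF16; ring. Qed.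
Lemma gf16_mul1 : left_id (GF16 1 0 0 0) gf16_mul.
Proof. by move=> [[] [] [] []]. Qed.
Lemma gf16_mulDl : left_distributive gf16_mul gf16_add.
Proof. by move=> [a0 a1 a2 a3] [b0 b1 b2 b3] [c0 c1 c2 c3]; congr GF16; ring. Qed.
Lemma gf16_1_neq0 : GF16 1 0 0 0 != 0. Proof. by []. Qed.

HB.instance Definition _ := GRing.Zmodule_isComNzRing.Build gf16
  gf16_mulA gf16_mulC gf16_mul1 gf16_mulDl gf16_1_neq0.

Lemma gf16_mulV (x : gf16) : x != 0 -> gf16_inv x * x = 1.
Proof. by move: x => [[] [] [] []]. Qed.
Lemma gf16_inv0 : gf16_inv 0 = 0. Proof. by []. Qed.

HB.instance Definition _ := GRing.ComNzRing_isField.Build gf16 gf16_mulV gf16_inv0.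

End GF16.

(* The 15 points of PG(3, 2), projected from a point of PG(3, 16): the nonzero *)
(* F_2-combinations of (1, 0, 0), (0, 1, 0), (0, 0, 1) and (t, t^2, t^3).       *)
Definition pg32 : seq (gf16 * gf16 * gf16) :=
  [seq let a := odd m in let b := odd m./2 in let c := odd m./2./2 in
       let d := odd m./2./2./2 in
       (GF16 a d false false, GF16 b false d false, GF16 c false false d)
    | m <- iota 1 15].

Lemma gf16_arrangement (w : seq (gf16 * gf16 * gf16)) :
  let zero x := x == 0%R in let o := (0 : gf16)%R in
  distinct_mod o gf16_add gf16_mul id zero w ->
  no_quadruple_mod o gf16_add gf16_mul id zero w ->
  has_arrangement (size w) (size (triples_mod o gf16_add gf16_mul id zero w)).
Proof. by move=> /=; apply: (@model_arrangement _ _ id). Qed.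

(** The centre (t, t^2, t^3, 1) of the projection lies in no plane defined over F_2, as 1, t, t^2,
    t^3 are independent over F_2. So no new collinearities arise, and the triples are the 35 lines
    of PG(3, 2), with three points each. *)
Lemma arrangement_15_35 : has_arrangement 15 35.
Proof. exact: (@gf16_arrangement pg32). Qed.

(** Each point of PG(3, 2) lies on 7 of its 35 lines. *)
Lemma arrangement_14_28 : has_arrangement 14 28.
Proof. exact: (@gf16_arrangement (behead pg32)). Qed.

(** * The values of [T3] *)

Lemma T3_ge s t : has_arrangement s t -> t <= T3 s.
Proof. by have [_] := T3P s; apply. Qed.

Lemma T3_le s t : (forall u, has_arrangement s u -> u <= t) -> T3 s <= t.
Proof. by have [h _] := T3P s; apply. Qed.

Lemma T3_schonheim s : 3 * T3 s <= s * s.-1./2.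
Proof. by have [h _] := T3P s; exact: has_arrangement_le_schonheim. Qed.

Lemma twelve_le t : has_arrangement 12 t -> t <= 19.
Proof.
move=> h; have := has_arrangement_le_schonheim h => /= h1.
have : t <> 20 by move=> e; apply: no_twelve_twenty; rewrite -e.
lia.
Qed.

Lemma thirteen_le t : has_arrangement 13 t -> t <= 24.
Proof.
move=> h; have /= h1 := has_arrangement_le_schonheim h.
have [t' /twelve_le t19 h2] := delete_line h.
(* Here [h2] and [t19] give 10 * t <= 13 * 19 = 247. *)
lia.
Qed.

Theorem theoremB :
  [/\ [/\ T3 12 = 19, 23 <= T3 13 <= 24, T3 14 = 28 & T3 15 = 35]
    & [/\ T3 16 = 37, 40 <= T3 17, T3 18 = 48 & T3 19 = 57]] /\
  (~ has_arrangement 12 20) /\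
  has_arrangement 12 19 /\
  (~ has_arrangement 13 25 /\ ~ has_arrangement 13 26) /\
  has_arrangement 13 23 /\
  has_arrangement 14 28 /\
  has_arrangement 15 35 /\
  has_arrangement 16 37 /\
  has_arrangement 17 40 /\
  has_arrangement 18 48 /\
  has_arrangement 19 57.
Proof.
(* An arrangement attaining the counting bound determines [T3]; this covers s = 14, 15, 16, 18 and
   19. *)
have eqT s t : 3 * t.+1 > s * s.-1./2 -> has_arrangement s t -> T3 s = t.
  by move=> lt /T3_ge ge; have := T3_schonheim s; lia.
split; last first.
  split; first exact: no_twelve_twenty.
  split; first exact: arrangement_12_19.
  split; first by split=> /thirteen_le.
  split; first exact: arrangement_13_23.
  split; first exact: arrangement_14_28.
  split; first exact: arrangement_15_35.
  split; first exact: arrangement_16_37.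
  split; first exact: arrangement_17_40.
  split; [exact: arrangement_18_48|exact: arrangement_19_57].
split; split.
- apply/eqP; rewrite eqn_leq (T3_ge arrangement_12_19) andbT.
  by apply: T3_le => t; apply: twelve_le.
- rewrite (T3_ge arrangement_13_23) /=; apply: T3_le => t; exact: thirteen_le.
- exact: eqT arrangement_14_28.
- exact: eqT arrangement_15_35.
- exact: eqT arrangement_16_37.
- exact: T3_ge arrangement_17_40.
- exact: eqT arrangement_18_48.
- exact: eqT arrangement_19_57.
Qed.
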